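(* Consider the decentralized detection scheme described in the context, with ideal channels between the sensors and the fusion center. Assume that $\mathsf{E}_i[l^k_1]\neq 0$ for all $k$ and $i\in\{0,1\}$, and that all expectations below are finite. Then for $i=0,1$ the average decision delay satisfies $$\mathsf{E}_i[\mathcal{T}] = \frac{\hat{I}_i(\mathcal{T})}{\hat{I}_i(1)} + \frac{\sum_{k=1}^K\Big(\hat{I}^k_i(t^k_{N^k_{\mathcal{T}}+1}) - \mathsf{E}_i[\mathcal{Y}_k]\,\hat{I}^k_i(1)\Big)}{\hat{I}_i(1)},$$ where $\mathcal{Y}_k \triangleq t^k_{N^k_{\mathcal{T}}+1}-\mathcal{T}$ is the time between the stopping time and the first sampling time of sensor $k$ after it.
   Context: There are $K$ sensors. Sensor $k$ observes $y^k_1,y^k_2,\dots$, which are i.i.d. with density $f^k_i$ under hypothesis $\mathsf{H}_i$ ($i=0,1$); observations at different sensors are independent. $\mathsf{P}_i,\mathsf{E}_i$ denote probability and expectation under $\mathsf{H}_i$. Let $l^k_t=\log\frac{f^k_1(y^k_t)}{f^k_0(y^k_t)}$ and $L^k_t=\sum_{s=1}^t l^k_s$, $L^k_0=0$. Fix $\Delta>0$. Level-triggered sampling: $t^k_0=0$, $t^k_n=\inf\{t>t^k_{n-1}: L^k_t-L^k_{t^k_{n-1}}\notin(-\Delta,\Delta)\}$; $\lambda^k_n=L^k_{t^k_n}-L^k_{t^k_{n-1}}$; $b^k_n=\mathrm{sign}(\lambda^k_n)\in\{1,-1\}$ is sent to the fusion center (FC). Local error probabilities: $\alpha_k=\mathsf{P}_0(b^k_n=1)$,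 $\beta_k=\mathsf{P}_1(b^k_n=-1)$ (independent of $n$). $N^k_t=\max\{n: t^k_n\le t\}$ is the number of bits sent by sensor $k$ up to time $t$. Ideal channel: the FC receives $b^k_n$ exactly and uses $\hat\lambda^k_n=\log\frac{1-\beta_k}{\alpha_k}$ if $b^k_n=1$ and $\hat\lambda^k_n=\log\frac{\beta_k}{1-\alpha_k}$ if $b^k_n=-1$. Global statistic $\hat L_t=\sum_{k=1}^K\sum_{n=1}^{N^k_t}\hat\lambda^k_n$; stopping time $\mathcal{T}=\inf\{t>0:\hat L_t\notin(-B,A)\}$ with thresholds $A,B>0$, deciding $\mathsf{H}_1$ if $\hat L_{\mathcal T}\ge A$ and $\mathsf{H}_0$ if $\hat L_{\mathcal T}\le -B$. Information quantities: $I^k_1(1)=\mathsf{E}_1[l^k_1]$, $I^k_0(1)=-\mathsf{E}_0[l^k_1]$; $I^k_1(t^k_1)=\mathsf{E}_1[\lambda^k_1]$, $I^k_0(t^k_1)=-\mathsf{E}_0[\lambda^k_1]$; $\hat I^k_1(t^k_1)=\mathsf{E}_1[\hat\lambda^k_1]$, $\hat I^k_0(t^k_1)=-\mathsf{E}_0[\hat\lambda^k_1]$; $\hat I^k_i(1)=\frac{\hat I^k_i(t^k_1)}{I^k_i(t^k_1)}I^k_i(1)$ and $\hat I_i(1)=\sum_{k=1}^K\hat I^k_i(1)$; $\hat I_1(\mathcal T)=\mathsf{E}_1[\hat L_{\mathcal T}]$, $\hat I_0(\mathcal T)=-\mathsf{E}_0[\hat L_{\mathcal T}]$; $\hat I^k_1(t^k_{N^k_{\mathcal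 T}+1})=\mathsf{E}_1[\hat\lambda^k_{N^k_{\mathcal T}+1}]$, $\hat I^k_0(t^k_{N^k_{\mathcal T}+1})=-\mathsf{E}_0[\hat\lambda^k_{N^k_{\mathcal T}+1}]$. *)

(* Defs.v *)
From HB Require Import structures.
From mathcomp Require Import all_boot all_order all_algebra finmap.
From mathcomp Require Import all_classical all_reals all_analysis.

Set Implicit Arguments.
Unset Strict Implicit.
Unset Printing Implicit Defensive.

Import Order.TTheory GRing.Theory Num.Theory.
Import numFieldNormedType.Exports.

Local Open Scope classical_set_scope.
Local Open Scope ring_scope.

(* inf {t | p t} when this set is nonempty; the default 0 is only used when the
   set is empty (an event of probability zero in the theorem). *)
Definition first_hit (p : pred nat) : nat :=
  match pselect (exists t, p t) with
  | left h => ex_minn h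
  | right _ => 0%N
  end.

Definition mutually_independent {d dY} {Omega : measurableType d}
  {Y : measurableType dY} {R : realType} (P : probability Omega R)
  {I : choiceType} (X : I -> Omega -> Y) : Prop :=
  forall (J : {fset I}) (A : I -> set Y),
    (forall j, j \in J -> measurable (A j)) ->
    P (\big[setI/setT]_(j <- J) (X j @^-1` A j)) =
    (\prod_(j <- J) P (X j @^-1` A j))%E.

(* Level-triggered sampling of one sensor, as a function of its path        *)
(* Lk : nat -> R of cumulative LLRs (Lk 0 = 0).                             *)

Section level_triggered.
Context {R : realType}.

Fixpoint samp_time (D : R) (Lk : nat -> R) (n : nat) : nat :=
  match n with
  | 0%N => 0%N
  | n'.+1 => let s := samp_time D Lk n' in
             first_hit (fun t => (s < t)%N && (Lk t - Lk s \notin `](- D), D[))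
  end.

Definition samp_incr (D : R) (Lk : nat -> R) (n : nat) : R :=
  Lk (samp_time D Lk n) - Lk (samp_time D Lk n.-1).

(* b_n = sign(lambda_n); true stands for +1, false for -1 *)
Definition samp_bit (D : R) (Lk : nat -> R) (n : nat) : bool :=
  0 < samp_incr D Lk n.

(* N_t = max{n : t_n <= t}; since t_n >= n, the max may be taken over n <= t *)
Definition samp_count (D : R) (Lk : nat -> R) (t : nat) : nat :=
  (\max_(n < t.+1 | (samp_time D Lk n <= t)%N) n)%N.

End level_triggered.

(*   P i          : the probability under hypothesis H_i (true = H_1)       *)
(*   y k s        : observation y^k_{s+1} of sensor k (time index shifted) *)
(*   f i k        : density of sensor k's observations under H_i           *)

Section scheme.
Context {d dY : measure_display} {Omega : measurableType d}
  {Y : measurableType dY} {R : realType} {K : nat}.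
Variables (P : bool -> probability Omega R) (y : 'I_K -> nat -> Omega -> Y)
  (f : bool -> 'I_K -> Y -> R) (D A B : R).

(* l^k_{s+1} = log f^k_1(y^k_{s+1}) / f^k_0(y^k_{s+1}) *)
Definition llr (k : 'I_K) (s : nat) (w : Omega) : R :=
  ln (f true k (y k s w) / f false k (y k s w)).

Definition cumLLR (k : 'I_K) (w : Omega) (t : nat) : R :=
  \sum_(s < t) llr k s w.

Definition tk (k : 'I_K) (n : nat) (w : Omega) : nat :=
  samp_time D (cumLLR k w) n.
Definition lambdak (k : 'I_K) (n : nat) (w : Omega) : R :=
  samp_incr D (cumLLR k w) n.
Definition bk (k : 'I_K) (n : nat) (w : Omega) : bool :=
  samp_bit D (cumLLR k w) n.
Definition Nk (k : 'I_K) (t : nat) (w : Omega) : nat :=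
  samp_count D (cumLLR k w) t.

Definition alphak (k : 'I_K) : R := fine (P false [set w | bk k 1 w]).
Definition betak (k : 'I_K) : R := fine (P true [set w | ~~ bk k 1 w]).

(* value used by the FC for the n-th bit of sensor k (ideal channel) *)
Definition hlambdak (k : 'I_K) (n : nat) (w : Omega) : R :=
  if bk k n w then ln ((1 - betak k) / alphak k)
  else ln (betak k / (1 - alphak k)).

Definition hL (t : nat) (w : Omega) : R :=
  \sum_(k < K) \sum_(1 <= n < (Nk k t w).+1) hlambdak k n w.

Definition stop_pred (w : Omega) : pred nat :=
  fun t => (0 < t)%N && (hL t w \notin `](- B), A[).

(* T = inf{t > 0 : \hat L_t \notin (-B, A)} (nat-valued; default 0 if never) *)
Definition Tstop (w : Omega) : nat := first_hit (stop_pred w).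

Definition Tstop_ext (w : Omega) : \bar R :=
  if pselect (exists t, stop_pred w t) then ((Tstop w)%:R)%:E else +oo%E.

Definition NkT (k : 'I_K) (w : Omega) : nat := Nk k (Tstop w) w.

Definition Yk (k : 'I_K) (w : Omega) : R :=
  (tk k (NkT k w).+1 w)%:R - (Tstop w)%:R.

Definition Info (i : bool) (X : Omega -> R) : R :=
  (if i then 1 else -1) * fine ('E_(P i)[X])%E.

Definition I_1 (i : bool) (k : 'I_K) : R := Info i (llr k 0).
Definition I_t1 (i : bool) (k : 'I_K) : R := Info i (lambdak k 1).
Definition hI_t1 (i : bool) (k : 'I_K) : R := Info i (hlambdak k 1).

Definition hI_1k (i : bool) (k : 'I_K) : R := hI_t1 i k / I_t1 i k * I_1 i k.
Definition hI_1 (i : bool) : R := \sum_(k < K) hI_1k i k.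

Definition hI_T (i : bool) : R := Info i (fun w => hL (Tstop w) w).
Definition hI_next (i : bool) (k : 'I_K) : R :=
  Info i (fun w => hlambdak k (NkT k w).+1 w).

End scheme.

(* Main.v *)
(** Fix [H_i] and a sensor [k], and let [M = N^k_T + 1] count the sampling times
    [t^k_n <= T], the one at 0 included.  That the instant [m] is such a time is
    decided by the observations before [m], so the Markov property at every [m]
    yields Wald's identity: the sum of [g] over the blocks starting at these
    instants has mean [E[M] * E[g (first block)]].  When [g] is the length of a
    block, this reads [E[T] + E[Y_k] = E[M] * E[t_1]]; when [g] is the value that
    the fusion center assigns to the bit of the block, it reads
    [E[sum_(n <= N_T + 1) hlambda_n] = E[M] * E[hlambda_1]].  Wald's identity for
    the random walk [L^k] up to [t_1] gives [E[lambda_1] = E[t_1] * E[l_1]], hence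
    [hI_k(1) = +- E[hlambda_1] / E[t_1]].  Eliminating [E[M]] and summing over [k]
    gives the formula multiplied by [hI(1)].

    One may divide by [hI(1)]: each [hI_k(t_1)] is the relative entropy of two
    Bernoulli laws, and if all of them vanished the global statistic would be
    identically 0 and would never leave [(-B, A)]. *)

Require Import Defs.
From HB Require Import structures.
From mathcomp Require Import all_boot all_order all_algebra finmap.
From mathcomp Require Import all_classical all_reals all_analysis.
From mathcomp Require Import measurable_realfun ring lra zify.

Set Implicit Arguments.
Unset Strict Implicit.
Unset Printing Implicit Defensive.

Import Order.TTheory GRing.Theory Num.Theory.
Import numFieldNormedType.Exports.
Local Open Scope classical_set_scope.
Local Open Scope ring_scope.

(** * Sample paths *)

(** Blocks are indexed by the deterministic instant [m] at which they start: numbering them by [n]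
    would call for a strong Markov property at the random times [t_n], whereas a series over [m]
    needs the Markov property at fixed times only. A block counts when it starts no later than [T],
    because this is known at its start; whether it also ends by [T] is not. The block that straddles
    [T] is therefore included, and it produces the correction terms with [Y_k] and [N_T + 1]. Two
    conventions are obstacles. The default 0 of [first_hit] makes a sampling time depend on the
    whole path when the path never leaves the strip; so the events are defined on truncated paths,
    and agree with the intended ones on almost every path, since a walk whose steps have nonzero
    mean leaves every strip. The conventions [x / 0 = 0] and [ln 0 = 0] enter the bit values when an
    error probability is 0 or 1; so relative entropy is used only after showing that a bit of given
    sign has probability zero under both hypotheses or under neither, by tracing it back to a single
    log-likelihood ratio of that sign. *)

Lemma first_hitP (p : pred nat) : (exists t, p t) ->
  p (first_hit p) /\ (forall i, (i < first_hit p)%N -> ~~ p i).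
Proof.
move=> ex; rewrite /first_hit; case: pselect => // h.
case: ex_minnP => m pm minm; split=> // i im; apply/negP => /minm.
by rewrite leqNgt im.
Qed.

Lemma first_hit_eq (p : pred nat) (j : nat) :
  p j -> (forall i, (i < j)%N -> ~~ p i) -> first_hit p = j.
Proof.
move=> pj minj; have [ph minh] := first_hitP (ex_intro _ j pj).
apply/eqP; rewrite eqn_leq; apply/andP; split; rewrite leqNgt; apply/negP => lt.
  by move: (minh _ lt); rewrite pj.
by move: (minj _ lt); rewrite ph.
Qed.

Lemma first_hit_none (p : pred nat) : (forall t, ~~ p t) -> first_hit p = 0%N.
Proof.
by move=> np; rewrite /first_hit; case: pselect => // -[t pt]; have := np t; rewrite pt.
Qed.

Section sampling_paths.
Context {R : realType}.
Implicit Types (D : R) (L p q : nat -> R).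

Definition exits D L (m : nat) (t : nat) : bool :=
  (m < t)%N && (L t - L m \notin `](- D), D[).

(** Required at every [m], not only at sampling times: the property then does not refer to the
    sampling times, and it is a countable intersection of events of equal probability. *)
Definition good_path D L := forall m, exists t, exits D L m t.

Definition cum p (t : nat) : R := \sum_(s < t) p s.

Definition shift (m : nat) p : nat -> R := fun s => p (m + s)%N.

(* The jumps [D + D] after time [m] force an immediate sampling, so [trunc] keeps
   the sampling times up to [m], depends on the coordinates before [m] only, and
   never meets the default value of [first_hit]. *)
Definition trunc D (m : nat) p : nat -> R :=
  fun s => if (s < m)%N then p s else D + D.

Lemma samp_timeS D L n :
  samp_time D L n.+1 = first_hit (exits D L (samp_time D L n)).
Proof. by []. Qed.

Lemma samp_time_exits D L n : good_path D L ->
  exits D L (samp_time D L n) (samp_time D L n.+1) /\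
  forall t, (t < samp_time D L n.+1)%N -> ~~ exits D L (samp_time D L n) t.
Proof. by move=> gL; rewrite samp_timeS; exact: first_hitP. Qed.

Lemma ltn_samp_timeS D L n : good_path D L ->
  (samp_time D L n < samp_time D L n.+1)%N.
Proof. by move=> gL; have [/andP[]] := samp_time_exits n gL. Qed.

Lemma ltn_samp_time D L : good_path D L ->
  {homo samp_time D L : m n / (m < n)%N}.
Proof. by move=> gL; apply: homo_ltn => [|n]; [exact: ltn_trans|exact: ltn_samp_timeS]. Qed.

Lemma leq_samp_time D L m n : good_path D L ->
  (samp_time D L m <= samp_time D L n)%N = (m <= n)%N.
Proof.
move=> gL; have [mn|nm] := leqP m n.
  move: mn; rewrite leq_eqVlt => /predU1P[->//|mn]; first by rewrite leqnn.
  exact/ltnW/ltn_samp_time.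
by apply/negbTE; rewrite -ltnNge; exact: ltn_samp_time.
Qed.

Lemma samp_time_ge D L n : good_path D L -> (n <= samp_time D L n)%N.
Proof.
by move=> gL; elim: n => // n ih; apply: leq_ltn_trans ih _; exact: ltn_samp_timeS.
Qed.

(** The Galois connection between counting and sampling times. The maximum is attained, as 0 is
    always admissible, and monotonicity of the sampling times does the rest. *)
Lemma leq_samp_count D L n t : good_path D L ->
  (n <= samp_count D L t)%N = (samp_time D L n <= t)%N.
Proof.
move=> gL; rewrite /samp_count; apply/idP/idP => [|snt].
  have [i /= it ->] : exists2 i : 'I_t.+1, (samp_time D L i <= t)%N &
      (\max_(i < t.+1 | (samp_time D L i <= t)%N) i)%N = i.
    have -> : (\max_(i < t.+1 | (samp_time D L i <= t)%N) i)%N =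
       (\max_(i in [pred i : 'I_t.+1 | (samp_time D L i <= t)%N]) i)%N by [].
    have : (0 < #|[pred i : 'I_t.+1 | (samp_time D L i <= t)%N]|)%N.
      by apply/card_gt0P; exists ord0; rewrite inE.
    by case/(eq_bigmax_cond (fun i : 'I_t.+1 => i : nat)) => i; rewrite inE => it ->; exists i.
  by move=> ni; apply: leq_trans it; rewrite leq_samp_time.
have nt : (n < t.+1)%N by rewrite ltnS (leq_trans _ snt)// samp_time_ge.
exact: (@leq_bigmax_cond _ (fun i : 'I_t.+1 => samp_time D L i <= t)%N (fun i => i : nat) (Ordinal nt)).
Qed.

Lemma samp_count_bounds D L t : good_path D L ->
  (samp_time D L (samp_count D L t) <= t < samp_time D L (samp_count D L t).+1)%N.
Proof.
move=> gL; rewrite -leq_samp_count// leqnn andTb ltnNge -leq_samp_count//.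
by rewrite ltnn.
Qed.

Lemma eq_first_hit_exits D L L' m n : good_path D L -> good_path D L' ->
  (forall t, (t <= m)%N -> L t = L' t) -> (n <= m)%N ->
  (first_hit (exits D L n) <= m)%N ->
  first_hit (exits D L' n) = first_hit (exits D L n).
Proof.
move=> gL gL' LL' nm; have [] := first_hitP (gL n).
set j := first_hit _ => ej minj jm; apply: first_hit_eq.
  by move: ej; rewrite /exits !LL'.
by move=> i ij; move: (minj _ ij); rewrite /exits !LL'// (leq_trans (ltnW ij)).
Qed.

(** The stopping-time property in terms of paths: a sampling time that falls by [m] is determined by
    the path up to [m]. This is what allows [trunc] to replace the true path. *)
Lemma eq_samp_time D L L' m n : good_path D L -> good_path D L' ->
  (forall t, (t <= m)%N -> L t = L' t) -> (samp_time D L n <= m)%N ->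
  samp_time D L' n = samp_time D L n.
Proof.
move=> gL gL' LL'; elim: n => // n ih snm.
have snm' : (samp_time D L n <= m)%N.
  exact/(leq_trans _ snm)/ltnW/ltn_samp_timeS.
by rewrite !samp_timeS ih// (eq_first_hit_exits gL gL' LL').
Qed.

Lemma eq_samp_count D L L' m t : good_path D L -> good_path D L' ->
  (forall t, (t <= m)%N -> L t = L' t) -> (t <= m)%N ->
  samp_count D L' t = samp_count D L t.
Proof.
move=> gL gL' LL' tm; apply/eqP; rewrite eqn_leq !leq_samp_count//.
have /andP[h1 _] := samp_count_bounds t gL.
have /andP[h2 _] := samp_count_bounds t gL'.
rewrite (eq_samp_time gL gL' LL') ?h1 ?(leq_trans h1)//.
by rewrite (@eq_samp_time _ L' L m) ?h2 ?(leq_trans h2)// => t' t'm; rewrite LL'.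
Qed.

Lemma eq_samp_incr D L L' m n : good_path D L -> good_path D L' ->
  (forall t, (t <= m)%N -> L t = L' t) -> (samp_time D L n <= m)%N ->
  samp_incr D L' n = samp_incr D L n.
Proof.
move=> gL gL' LL' snm; rewrite /samp_incr.
have snm' : (samp_time D L n.-1 <= m)%N.
  by apply: leq_trans snm; rewrite leq_samp_time// leq_pred.
by rewrite !(eq_samp_time gL gL' LL')// !LL'.
Qed.

Lemma cum0 p : cum p 0 = 0. Proof. by rewrite /cum big_ord0. Qed.

Lemma cumS p t : cum p t.+1 = cum p t + p t.
Proof. by rewrite /cum big_ord_recr. Qed.

Lemma cum_shift m p t : cum (shift m p) t = cum p (m + t)%N - cum p m.
Proof.
by elim: t => [|t ih]; rewrite ?addn0 ?subrr ?cum0// addnS !cumS ih addrAC.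
Qed.

Lemma exits_shift D m p t : exits D (cum (shift m p)) 0 t = exits D (cum p) m (m + t).
Proof.
by rewrite /exits cum0 subr0 cum_shift -ltn_subLR ?subnn //.
Qed.

Lemma first_hit_exits_shift D m p : good_path D (cum p) ->
  first_hit (exits D (cum p) m) = (m + samp_time D (cum (shift m p)) 1)%N.
Proof.
move=> gp; have [eh minh] := first_hitP (gp m).
have mh : (m < first_hit (exits D (cum p) m))%N by case/andP: eh.
suff e : first_hit (exits D (cum (shift m p)) 0) =
    (first_hit (exits D (cum p) m) - m)%N by rewrite samp_timeS /= e subnKC// ltnW.
apply: first_hit_eq => [|i im]; first by rewrite exits_shift subnKC// ltnW.
by rewrite exits_shift minh//; lia.
Qed.

(** Renewal structure: each block is the first block of a shifted path, so a sum over blocks is the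
    sum of one functional along shifts. *)
Lemma samp_timeS_shift D p n : good_path D (cum p) ->
  samp_time D (cum p) n.+1 = (samp_time D (cum p) n +
    samp_time D (cum (shift (samp_time D (cum p) n) p)) 1)%N.
Proof. by move=> gp; rewrite -first_hit_exits_shift. Qed.

Lemma samp_incrS_shift D p n : good_path D (cum p) ->
  samp_incr D (cum p) n.+1 =
  samp_incr D (cum (shift (samp_time D (cum p) n) p)) 1.
Proof.
move=> gp; rewrite /samp_incr samp_timeS_shift// -[in RHS]pred_Sn.
by rewrite [samp_time _ _ 0]/= cum0 subr0 cum_shift.
Qed.

Lemma cum_trunc D m p t : (t <= m)%N -> cum (trunc D m p) t = cum p t.
Proof.
move=> tm; apply: eq_bigr => i _; rewrite /trunc ifT//.
by rewrite (leq_trans (ltn_ord i)).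
Qed.

(** If the increment since [r] is still inside the strip at time [maxn m r], it exceeds [- D], and
    the next jump of [D + D] lifts it above [D]. *)
Lemma good_path_trunc D m p : 0 < D -> good_path D (cum (trunc D m p)).
Proof.
move=> D0 r; pose T := maxn m r; set L := cum _.
have [e|] := boolP (exits D L r T); first by exists T.
rewrite /exits negb_and negbK => TrD.
have LT : L T - L r \in `](- D), D[.
  case/orP: TrD => //; rewrite -leqNgt geq_max leqnn andbT => mr.
  by rewrite /T (maxn_idPr mr) subrr in_itv/= oppr_lt0 D0.
exists T.+1; rewrite /exits ltnS leq_maxr/= /L cumS /trunc.
rewrite ifF; last by rewrite ltnNge leq_maxl.
move: LT; rewrite !in_itv/= => /andP[L1 L2]; apply/negP => /andP[_].
rewrite -/(trunc D m p) -/L; lra.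
Qed.

End sampling_paths.

(** * Sums over sampling instants *)

Section sampling_sums.
Context {R : realType}.
Implicit Types (D : R) (L p : nat -> R).

(** Searching [n <= m] suffices on a good path because [t_n >= n], and it keeps the predicate
    Boolean. *)
Definition is_samp D L (m : nat) : bool :=
  [exists n : 'I_m.+1, samp_time D L n == m].

Lemma is_sampP D L m : good_path D L ->
  reflect (exists n, samp_time D L n = m) (is_samp D L m).
Proof.
move=> gL; apply: (iffP existsP) => [[n /eqP <-]|[n snm]]; first by exists n.
have nm : (n < m.+1)%N by rewrite ltnS -snm samp_time_ge.
by exists (Ordinal nm) => /=; rewrite snm.
Qed.

(** The change of index [m = t_n], from instants, where the Markov property applies, to block
    numbers. It is injective because sampling times increase strictly. *)
Lemma sum_is_samp (V : nmodType) D L (F : nat -> V) t : good_path D L ->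
  \sum_(m < t.+1 | is_samp D L m) F m =
  \sum_(n < (samp_count D L t).+1) F (samp_time D L n).
Proof.
move=> gL; rewrite -(big_mkord (is_samp D L)) -big_filter.
rewrite -(big_mkord xpredT (fun n => F (samp_time D L n))).
rewrite -(big_map (samp_time D L) xpredT); apply: perm_big.
apply: uniq_perm.
- by rewrite filter_uniq// iota_uniq.
- rewrite map_inj_uniq ?iota_uniq// => m n smn.
  by case: (ltngtP m n) => // /(ltn_samp_time gL); rewrite smn ltnn.
move=> m; rewrite mem_filter mem_index_iota leq0n andTb ltnS.
apply/andP/mapP => [[/(is_sampP _ gL)[n <-] st]|[n]].
  by exists n => //; rewrite mem_index_iota ltnS leq_samp_count.
rewrite mem_index_iota ltnS leq_samp_count//= => nt ->; split=> //.
by apply/(is_sampP _ gL); exists n.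
Qed.

Lemma sum_interarrival D p n : good_path D (cum p) ->
  (\sum_(i < n) samp_time D (cum (shift (samp_time D (cum p) i) p)) 1)%N =
  samp_time D (cum p) n.
Proof.
move=> gp; elim: n => [|n ih]; first by rewrite big_ord0.
by rewrite big_ord_recr ih [RHS]samp_timeS_shift.
Qed.

Lemma eq_is_samp D L L' m : good_path D L -> good_path D L' ->
  (forall t, (t <= m)%N -> L t = L' t) -> is_samp D L' m = is_samp D L m.
Proof.
move=> gL gL' LL'.
apply/(is_sampP _ gL')/(is_sampP _ gL) => -[n snm]; subst m; exists n.
  by apply: (eq_samp_time gL' gL _ (leqnn _)) => t tm; rewrite LL'.
exact: (eq_samp_time gL gL' LL' (leqnn _)).
Qed.

End sampling_sums.

(** * Measurability of hitting times and of evaluation at a random index *)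

Section measurability_nat.
Context {d : measure_display} {T : measurableType d}.

Lemma measurable_fun_natP (N : T -> nat) :
  (forall n, measurable [set w | N w = n]) -> measurable_fun setT N.
Proof.
move=> mN _ B _; rewrite setTI.
rewrite (_ : _ @^-1` _ = \bigcup_(n in B) [set w | N w = n]).
  by apply: bigcup_measurable => n _; exact: mN.
by apply/seteqP; split => [w Bw|w [n Bn /= wn]]; [exists (N w)|rewrite /= wn].
Qed.

Lemma measurable_setb (b : T -> bool) :
  measurable_fun setT b -> measurable [set w | b w].
Proof. by move=> mb; rewrite -[X in measurable X]setTI; exact: (mb _ [set true]). Qed.

Lemma measurable_fun_setb (b : T -> bool) :
  measurable [set w | b w] -> measurable_fun setT b.
Proof. by move=> mb; apply: (measurable_fun_bool true); rewrite setTI. Qed.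

Lemma measurable_fun_eval d' (S : measurableType d') (F : T -> nat -> S)
    (N : T -> nat) : measurable_fun setT N ->
  (forall n, measurable_fun setT (F^~ n)) ->
  measurable_fun setT (fun w => F w (N w)).
Proof.
move=> mN mF _ B mB; rewrite setTI.
rewrite (_ : _ @^-1` _ = \bigcup_n (N @^-1` [set n] `&` (F^~ n) @^-1` B)).
  apply: bigcup_measurable => n _; apply: measurableI.
    by rewrite -[X in measurable X]setTI; exact: mN.
  by rewrite -[X in measurable X]setTI; exact: mF.
by apply/seteqP; split => [w Bw|w [n _ [/= <-]]]//; exists (N w).
Qed.

Lemma measurable_first_hit (q : T -> pred nat) :
  (forall t, measurable_fun setT (fun w => q w t)) ->
  measurable_fun setT (fun w => first_hit (q w)).
Proof.
move=> mq; apply: measurable_fun_natP => j.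
pose A := [set w | q w j] `&` \bigcap_(i in [set i | (i < j)%N]) [set w | ~~ q w i].
pose Z := \bigcap_i [set w | ~~ q w i].
have mA : measurable A.
  apply: measurableI; first exact: measurable_setb.
  by apply: bigcap_measurableType => i _; apply: measurable_setb; exact: measurable_neg.
have mZ : measurable Z.
  by apply: bigcap_measurableType => i _; apply: measurable_setb; exact: measurable_neg.
(* The default value of [first_hit] adds the event of no hit at all to the fibre over 0. *)
have -> : [set w | first_hit (q w) = j] = A `|` (if j == 0%N then Z else set0).
  apply/seteqP; split => [w /= fj|w [[/= qj nq]|]].
  - have [/first_hitP[qh nqh]|nq] := pselect (exists t, q w t).
      by left; rewrite /A -fj; split => //= i; exact: nqh.
    right; have {}nq t : ~~ q w t by apply/negP => qt; apply: nq; exists t.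
    by rewrite -fj (first_hit_none nq)/= => i _; exact: nq.
  - by apply: first_hit_eq => // i ij; exact: nq.
  - case: eqP => // -> Zw; apply: first_hit_none => t; exact: Zw.
by apply: measurableU => //; case: ifP.
Qed.

End measurability_nat.

(** * Measurability of the sampling scheme *)

Section measurability_sampling.
Context {d : measure_display} {T : measurableType d} {R : realType}.
Variables (D : R) (L : T -> nat -> R).
Hypothesis mL : forall t, measurable_fun setT (L^~ t).

Lemma measurable_exits m t : measurable_fun setT (fun w => exits D (L w) m t).
Proof.
apply: measurable_and; first exact: measurable_cst.
apply: measurable_neg.
rewrite (_ : (fun w => _) = (fun w => (- D < L w t - L w m) && (L w t - L w m < D))).
  by apply: measurable_and; apply: measurable_fun_ltr => //; exact: measurable_funB.
by apply/funext => w; rewrite in_itv.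
Qed.

Lemma measurable_samp_time n : measurable_fun setT (fun w => samp_time D (L w) n).
Proof.
elim: n => [|n ih]; first exact: measurable_cst.
apply: (measurable_fun_eval (F := fun w m => first_hit (exits D (L w) m)) ih) => m.
by apply: measurable_first_hit => t; exact: measurable_exits.
Qed.

Lemma measurable_samp_incr n : measurable_fun setT (fun w => samp_incr D (L w) n).
Proof.
by apply: measurable_funB; apply: measurable_fun_eval => //; exact: measurable_samp_time.
Qed.

Lemma measurable_samp_bit n : measurable_fun setT (fun w => samp_bit D (L w) n).
Proof. by apply: measurable_fun_ltr => //; exact: measurable_samp_incr. Qed.

Lemma measurable_samp_count t : measurable_fun setT (fun w => samp_count D (L w) t).
Proof.
rewrite /samp_count; under eq_fun do rewrite big_mkcond.
elim: (index_enum _) => [|i s ih].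
  by under eq_fun do rewrite big_nil; exact: measurable_cst.
under eq_fun do rewrite big_cons; apply: measurable_fun_maxn => //.
apply: measurable_fun_ifT; [|exact: measurable_cst|exact: measurable_cst].
by apply: measurable_fun_leq => //; exact: measurable_samp_time.
Qed.

Lemma measurable_is_samp m : measurable_fun setT (fun w => is_samp D (L w) m).
Proof.
apply: measurable_fun_setb.
rewrite (_ : [set w | _] = \bigcup_(n in [set n | (n < m.+1)%N])
    [set w | samp_time D (L w) n == m]).
  apply: bigcup_measurable => n _; apply: measurable_setb.
  by apply: measurable_fun_eqn => //; exact: measurable_samp_time.
apply/seteqP; split => [w /existsP[n sn]|w [n nm /= sn]]; first by exists n => /=.
by apply/existsP; exists (Ordinal nm).
Qed.

End measurability_sampling.

(** * Path space and past sigma-algebras *)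

Local Open Scope ereal_scope.

(** Provides the image measure as a bundled measure, to which uniqueness and scaling of measures can
    be applied. *)
Lemma pushforward_measure d d' (T : measurableType d) (T' : measurableType d')
    (R : realType) (m : {measure set T -> \bar R}) (f : T -> T') :
  measurable_fun setT f ->
  exists m' : {measure set T' -> \bar R}, m' = pushforward m f :> (set T' -> \bar R).
Proof.
move=> mf.
by exists (measure_function_pushforward__canonical__measure_function_Measure m mf).
Qed.

Lemma integral_mrestr d (T : measurableType d) (R : realType)
    (m : {measure set T -> \bar R}) (E : set T) (mE : measurable E) (f : T -> \bar R) :
  measurable_fun setT f -> (forall x, 0 <= f x) ->
  \int[mrestr m mE]_x f x = \int[m]_(x in E) f x.
Proof.
move=> mf f0; rewrite (@ge0_negligible_integral _ _ _ _ setT (~` E))//=.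
- rewrite setTD setCK; apply: eq_measure_integral => A mA AE.
  by rewrite /= /mrestr setIidl.
- exact: measurableC.
- by rewrite /mrestr setICl measure0.
Qed.

(* [measurableTypeR R] instead of [R], which is not canonically pointed. *)
Definition path_cyl (R : realType) : set (set (nat -> measurableTypeR R)) :=
  [set C | exists N (B : nat -> set R), (forall s, measurable (B s)) /\
    C = [set p | forall s, (s < N)%N -> B s (p s)]].

Arguments path_cyl R : clear implicits.
Notation path_space R := (g_sigma_algebraType (path_cyl R)).

Lemma setI_closed_path_cyl (R : realType) : setI_closed (path_cyl R).
Proof.
move=> _ _ [N1 [B1 [mB1 ->]]] [N2 [B2 [mB2 ->]]].
exists (maxn N1 N2), (fun s => (if (s < N1)%N then B1 s else setT) `&`
  (if (s < N2)%N then B2 s else setT)); split.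
  by move=> s; apply: measurableI; case: ifP.
apply/seteqP; split => [p [/= h1 h2] s sN|p /= h].
  by split; case: ifP => // ?; [exact: h1|exact: h2].
split => /= s sN.
  by have := h s; rewrite leq_max sN => /(_ isT)[].
by have := h s; rewrite leq_max sN orbT => /(_ isT)[].
Qed.

Lemma path_cylT (R : realType) : path_cyl R setT.
Proof.
exists 0%N, (fun=> setT); split => //.
by apply/seteqP; split.
Qed.

Lemma measurable_coord (R : realType) (s : nat) :
  measurable_fun setT (fun p : path_space R => p s).
Proof.
move=> _ B mB; rewrite setTI; apply: sub_sigma_algebra.
exists s.+1, (fun i => if i == s then B else setT); split.
  by move=> i; case: ifP.
apply/seteqP; split => [p Bp i _|p /(_ s (ltnSn s))] /=; last by rewrite eqxx.
by case: eqP => // ->.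
Qed.

Section iid_process.
Context {d : measure_display} {Omega : measurableType d} {R : realType} {K : nat}.
Variables (P : probability Omega R) (X : 'I_K -> nat -> Omega -> R).

(** Independence is stated for boxes over all sensors and the first [N] instants; smaller families
    arise by taking some factors to be [setT]. Laws may differ between sensors. *)
Definition iid_process :=
  [/\ forall k s, measurable_fun setT (X k s),
      forall N (A : 'I_K -> nat -> set R), (forall k s, measurable (A k s)) ->
        P [set w | forall k s, (s < N)%N -> A k s (X k s w)] =
        \prod_(k < K) \prod_(s < N) P (X k s @^-1` A k s) &
      forall k s A, measurable A -> P (X k s @^-1` A) = P (X k 0%N @^-1` A)].

(** The past involves all sensors, since the stopping time does, whereas [future] follows a single
    one. *)
Definition past_cyl (m : nat) : set (set Omega) :=
  [set E | exists A : 'I_K -> nat -> set R, (forall k s, measurable (A k s)) /\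
    E = [set w | forall k s, (s < m)%N -> A k s (X k s w)]].

Definition future (k : 'I_K) (m : nat) (w : Omega) : path_space R :=
  fun s => X k (m + s)%N w.

Lemma setI_closed_past_cyl m : setI_closed (past_cyl m).
Proof.
move=> _ _ [A1 [mA1 ->]] [A2 [mA2 ->]].
exists (fun k s => A1 k s `&` A2 k s); split.
  by move=> k s; apply: measurableI.
apply/seteqP; split => [w [/= h1 h2] k s sN|w /= h].
  by split; [exact: h1|exact: h2].
by split => k s sm; have [] := h k s sm.
Qed.

Lemma past_cylT m : past_cyl m setT.
Proof. by exists (fun _ _ => setT); split => //; apply/seteqP; split. Qed.

Lemma measurable_past_coord m k s : (s < m)%N ->
  measurable_fun setT (X k s : g_sigma_algebraType (past_cyl m) -> R).
Proof.
move=> sm _ B mB; rewrite setTI; apply: sub_sigma_algebra.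
exists (fun k' i => if (k' == k) && (i == s) then B else setT); split.
  by move=> k' i; case: ifP.
apply/seteqP; split => [w Bw k' i _|w /(_ k s sm)] /=; last by rewrite !eqxx.
by case: ifP => // /andP[/eqP -> /eqP ->].
Qed.

Hypothesis iidX : iid_process.

Let mX k s : measurable_fun setT (X k s). Proof. by case: iidX. Qed.

Lemma past_cyl_measurable m : past_cyl m `<=` measurable.
Proof.
move=> _ [A [mA ->]].
rewrite (_ : mkset _ = \bigcap_(k in [set: 'I_K]) \bigcap_(s in [set s | (s < m)%N])
    (X k s @^-1` A k s)).
  apply: fin_bigcap_measurable => // k _; apply: bigcap_measurableType => s _.
  by rewrite -[X in measurable X]setTI; exact: mX.
by apply/seteqP; split => [w h k _ s sm|w h k s sm]; [exact: h|exact: (h k Logic.I s)].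
Qed.

Lemma past_measurable m E : <<s past_cyl m >> E -> measurable E.
Proof.
apply: smallest_sub; last exact: past_cyl_measurable.
exact: sigma_algebra_measurable.
Qed.

Lemma measurable_future k m : measurable_fun setT (future k m).
Proof.
refine (@measurability _ _ _ (path_space R) _ _ (path_cyl R) _ _) => //.
move=> _ [_ [N [B [mB ->]] <-]]; rewrite setTI.
rewrite (_ : _ @^-1` _ = \bigcap_(s in [set s | (s < N)%N])
    (X k (m + s)%N @^-1` B s)).
  apply: bigcap_measurableType => s _.
  by rewrite -[X in measurable X]setTI; exact: mX.
by apply/seteqP; split.
Qed.

Lemma measurable_future_preimage k m F : <<s path_cyl R >> F ->
  measurable (future k m @^-1` F).
Proof.
by move=> mF; rewrite -[X in measurable X]setTI; exact: measurable_future.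
Qed.

End iid_process.

(** * Markov property *)

Section markov.
Context {d : measure_display} {Omega : measurableType d} {R : realType} {K : nat}.
Variables (P : probability Omega R) (X : 'I_K -> nat -> Omega -> R).
Hypothesis iidX : iid_process P X.

Let mX k s : measurable_fun setT (X k s). Proof. by case: iidX. Qed.

(** The intersection is again a box, over the first [m + N] instants, so its product splits at [m];
    identical distribution moves the second factor back to time 0. *)
Lemma markov_cyl k m E C : past_cyl X m E -> path_cyl R C ->
  P (E `&` future X k m @^-1` C) = P E * P (future X k 0 @^-1` C).
Proof.
case: iidX => _ indX idX [A [mA ->]] [N [B [mB ->]]].
pose A' k' s := if (s < m)%N then A k' s else
   if k' == k then B (s - m)%N else setT.
have mA' k' s : measurable (A' k' s) by rewrite /A'; do 2 case: ifP => // _.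
pose B' k' s := if k' == k then B s else setT.
have mB' k' s : measurable (B' k' s) by rewrite /B'; case: ifP => // _.
rewrite [X in P X](_ : _ = [set w | forall k s, (s < m + N)%N -> A' k s (X k s w)]);
    last first.
  apply/seteqP; split => [w [/= h1 h2] k' s smN|w /= h].
    rewrite /A'; case: ltnP => sm; first exact: h1.
    case: eqP => // ->; rewrite -{2}(subnKC sm).
    by apply: h2; rewrite ltn_subLR.
  split => [k' s sm|s sN].
    by have := h k' s (ltn_addr N sm); rewrite /A' sm.
  have := h k (m + s)%N; rewrite ltn_add2l => /(_ sN).
  by rewrite /A' ltnNge leq_addr/= eqxx addKn.
rewrite [X in _ = _ * P X](_ : _ = [set w | forall k s, (s < N)%N -> B' k s (X k s w)]);
    last first.
  apply/seteqP; split => [w h1 k' s sN|w /= h s sN].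
    by rewrite /B'; case: eqP => // ->; exact: (h1 s).
  by have := h k s sN; rewrite /B' eqxx.
rewrite !indX// -big_split/=; apply: eq_bigr => k' _.
rewrite big_split_ord/=; congr (_ * _); apply: eq_bigr => s _.
  by rewrite /A' ltn_ord.
rewrite /A' /B' ltnNge leq_addr/= addKn.
by case: ifP => _; [rewrite idX// [RHS]idX|rewrite !preimage_setT].
Qed.

Let mfuture k m : measurable_fun setT (future X k m).
Proof. exact: (measurable_future iidX). Qed.

Let sub_past m : <<s past_cyl X m >> `<=` measurable.
Proof. exact: (past_measurable iidX). Qed.

Let fineP (A : set Omega) : measurable A -> (fine (P A))%:E = P A.
Proof. by move=> mA; rewrite fineK// fin_num_measure. Qed.

(** For fixed [E] both sides are finite measures in [F] that agree on the pi-system of path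
    cylinders. *)
Let markov_past_cyl k m E F : past_cyl X m E -> <<s path_cyl R >> F ->
  P (E `&` future X k m @^-1` F) = P E * P (future X k 0 @^-1` F).
Proof.
move=> GE mF.
have mE : measurable E by apply: (@sub_past m); exact: sub_sigma_algebra.
have mtF n G : <<s path_cyl R >> G -> measurable (future X k n @^-1` G).
  exact: (measurable_future_preimage iidX).
have [m1 m1E] := pushforward_measure (mrestr P mE) (mfuture k m).
have [m2 m2E] := pushforward_measure (mscale (NngNum (fine_ge0 (measure_ge0 P E))) P) (mfuture k 0).
have : m1 F = m2 F.
  apply: (@measure_unique _ _ (path_space R) (path_cyl R) (fun=> setT)) => //.
  - exact: setI_closed_path_cyl.
  - by move=> _; exact: path_cylT.
  - by rewrite bigcup_const//; exists 0%N.
  - move=> C GC; rewrite m1E m2E /pushforward/= /mrestr/= /mscale/= fineP//.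
    by rewrite setIC markov_cyl.
  - by move=> _; rewrite m1E /pushforward/= /mrestr preimage_setT setTI -ge0_fin_numE// fin_num_measure.
by rewrite m1E m2E /pushforward /= /mrestr /mscale/= fineP// setIC.
Qed.

(** The same uniqueness argument in the other variable: [F] is fixed and [E] ranges over the
    past. *)
Lemma markov k m E F : <<s past_cyl X m >> E -> <<s path_cyl R >> F ->
  P (E `&` future X k m @^-1` F) = P E * P (future X k 0 @^-1` F).
Proof.
move=> mE mF.
have mtF n : measurable (future X k n @^-1` F).
  exact: (measurable_future_preimage iidX).
pose m1 := mrestr P (mtF m).
pose m2 := mscale (NngNum (fine_ge0 (measure_ge0 P (future X k 0 @^-1` F)))) P.
have : m1 E = m2 E.
  apply: (@g_sigma_algebra_measure_unique _ _ _ (past_cyl X m) _ (fun=> setT)) mE => //.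
  - exact: (past_cyl_measurable iidX).
  - by move=> _; exact: past_cylT.
  - by rewrite bigcup_const//; exists 0%N.
  - exact: setI_closed_past_cyl.
  - move=> C GC; rewrite /m1 /m2/= /mrestr/= /mscale/= fineP//.
    by rewrite muleC markov_past_cyl.
  - by move=> _; rewrite /m1/= /mrestr setTI -ge0_fin_numE// fin_num_measure//; exact: mtF.
by rewrite /m1 /m2 /mrestr /mscale/= fineP// muleC.
Qed.

Lemma stationary k m F : <<s path_cyl R >> F ->
  P (future X k m @^-1` F) = P (future X k 0 @^-1` F).
Proof.
move=> mF; have := @markov k m setT F; rewrite setTI probability_setT mul1e; apply => //.
by apply: sub_sigma_algebra; exact: past_cylT.
Qed.

(** By [markov], the image under [future X k m] of [P] restricted to [E] is [P E] times the law of
    the whole path; no approximation of [g] is needed. *)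
Lemma integral_markov k m E (g : path_space R -> \bar R) :
  <<s past_cyl X m >> E -> measurable_fun setT g -> (forall p, 0 <= g p) ->
  \int[P]_(w in E) g (future X k m w) = P E * \int[P]_w g (future X k 0 w).
Proof.
move=> GE mg g0; have mE := sub_past GE.
rewrite -(@integral_mrestr _ _ _ P E mE (fun w => g (future X k m w)))//; last first.
  by apply: measurableT_comp.
have e0 := ge0_integral_pushforward (mfuture k 0) P measurableT mg (fun x _ => g0 x).
have em := ge0_integral_pushforward (mfuture k m) (mrestr P mE) measurableT mg (fun x _ => g0 x).
rewrite !preimage_setT in e0 em; rewrite -[LHS]em -[in RHS]e0.
have [m0 m0E] := pushforward_measure P (mfuture k 0).
rewrite -m0E -fineP//.
rewrite -(ge0_integral_mscale m0 measurableT (NngNum (fine_ge0 (measure_ge0 P E))) mg)//.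
apply: eq_measure_integral => F mF _.
have e1 : mscale (NngNum (fine_ge0 (measure_ge0 P E))) m0 F =
  P E * P (future X k 0 @^-1` F) by rewrite /mscale m0E /= fineP.
have e2 : pushforward (mrestr P mE) (future X k m) F =
  P E * P (future X k 0 @^-1` F) by rewrite -(markov k GE)// /pushforward /mrestr setIC.
exact: etrans e2 (esym e1).
Qed.

End markov.

(** * Wald's identity *)

Lemma nneseries_finite (R : realType) (u : nat -> \bar R) n :
  (forall m, 0 <= u m) -> (forall m, (n <= m)%N -> u m = 0) ->
  \sum_(m <oo) u m = \sum_(m < n) u m.
Proof.
move=> u0 un; rewrite (nneseries_split 0 n)// add0n big_mkord.
by rewrite [X in _ + X]eseries0 ?adde0// => m nm _; exact: un.
Qed.

Section wald.
Context {d : measure_display} {Omega : measurableType d} {R : realType} {K : nat}.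
Variables (P : probability Omega R) (X : 'I_K -> nat -> Omega -> R).
Hypothesis iidX : iid_process P X.
Variables (k : 'I_K) (E : nat -> set Omega).
Hypothesis pastE : forall m, <<s past_cyl X m >> (E m).
Hypothesis sumE : \sum_(m <oo) P (E m) < +oo.

Let mE m : measurable (E m). Proof. exact: (@past_measurable _ _ _ _ _ _ iidX m (E m) (@pastE m)). Qed.

Let mfuture k' m : measurable_fun setT (future X k' m).
Proof. exact: (measurable_future iidX). Qed.

(** Extended-real valued, so that for [g >= 0] it makes sense at every [w] and monotone convergence
    exchanges sum and integral. *)
Definition stopped_sum (g : path_space R -> R) (w : Omega) : \bar R :=
  \sum_(m <oo) ((fun w => (g (future X k m w))%:E) \_ (E m)) w.

Let measurable_term (g : path_space R -> R) m : measurable_fun setT g ->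
  measurable_fun setT ((fun w => (g (future X k m w))%:E) \_ (E m)).
Proof.
move=> mg; apply/(measurable_restrictT _ (mE m)).
apply: measurable_funTS; apply/measurable_EFinP.
exact: measurableT_comp.
Qed.

Lemma measurable_stopped_sum (g : path_space R -> R) : measurable_fun setT g -> (forall p, 0 <= g p)%R ->
  measurable_fun setT (stopped_sum g).
Proof.
move=> mg g0.
have := @ge0_emeasurable_sum _ _ _ setT (fun m => (fun w => (g (future X k m w))%:E) \_ (E m)) xpredT.
apply; last by move=> m _; exact: measurable_term.
by move=> m w _ _; rewrite patchE; case: ifP => // _; rewrite lee_fin.
Qed.

Lemma stopped_sum_ge0 (g : path_space R -> R) w : (forall p, 0 <= g p)%R -> 0 <= stopped_sum g w.
Proof.
by move=> g0; apply: nneseries_ge0 => m _ _; rewrite patchE; case: ifP => // _; rewrite lee_fin.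
Qed.

Lemma stopped_sum_finite (g : path_space R -> R) w n : (forall p, 0 <= g p)%R ->
  (forall m, (n <= m)%N -> ~ E m w) ->
  stopped_sum g w = (\sum_(m < n | w \in E m) g (future X k m w))%:E.
Proof.
move=> g0 nE; rewrite /stopped_sum (nneseries_finite (n := n)).
- rewrite [in RHS]big_mkcond -sumEFin; apply: eq_bigr => m _.
  by rewrite patchE; case: ifP.
- by move=> m; rewrite patchE; case: ifP => // _; rewrite lee_fin.
- by move=> m nm; rewrite patchE memNset//; exact: nE.
Qed.

Lemma wald_ge0 (g : path_space R -> R) : measurable_fun setT g -> (forall p, 0 <= g p)%R ->
  \int[P]_w (g (future X k 0 w))%:E < +oo ->
  \int[P]_w stopped_sum g w =
  (\sum_(m <oo) P (E m)) * \int[P]_w (g (future X k 0 w))%:E.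
Proof.
move=> mg g0 ig.
have ig0 : 0 <= \int[P]_w (g (future X k 0 w))%:E.
  by apply: integral_ge0 => w _; rewrite lee_fin.
rewrite integral_nneseries//; last 2 first.
- by move=> m; exact: measurable_term.
- by move=> m w _; rewrite patchE; case: ifP => // _; rewrite lee_fin.
rewrite -[X in _ * X]fineK ?ge0_fin_numE// muleC -nneseriesZl//.
apply: congr_lim; apply/funext => n /=; apply: eq_bigr => m _.
rewrite -integral_mkcond.
have mEg : measurable_fun setT (EFin \o g) by exact/measurable_EFinP.
have Eg0 p : 0 <= (EFin \o g) p by rewrite lee_fin.
rewrite (integral_markov iidX k (@pastE m) mEg Eg0).
by rewrite muleC fineK ?ge0_fin_numE.
Qed.

(** Positive and negative parts of [g] are treated by [wald_ge0]; finiteness of the series of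
    [P (E m)] makes both stopped sums integrable, so that they may be subtracted. Two families are
    used below: [never] yields the classical identity for a random walk, [active] the identity for
    blocks. *)
Lemma wald (g : path_space R -> R) (f : Omega -> R) : measurable_fun setT g -> measurable_fun setT f ->
  P.-integrable setT (EFin \o (fun w => g (future X k 0 w))) ->
  {ae P, forall w, exists n, (forall m, (n <= m)%N -> ~ E m w) /\
    f w = (\sum_(m < n | w \in E m) g (future X k m w))%R} ->
  \int[P]_w (f w)%:E =
  (\sum_(m <oo) P (E m)) * \int[P]_w (g (future X k 0 w))%:E.
Proof.
move=> mg mf ig fg.
pose gp p := Num.max (g p) 0%R; pose gn p := Num.max (- g p)%R 0%R.
have gE p : g p = (gp p - gn p)%R.
  by rewrite /gp /gn; case: (leP (g p) 0%R) => h; case: (leP (- g p)%R 0%R); lra.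
have gp0 p : (0 <= gp p)%R by rewrite /gp le_max lexx orbT.
have gn0 p : (0 <= gn p)%R by rewrite /gn le_max lexx orbT.
have mgp : measurable_fun setT gp by apply: measurable_maxr.
have mgn : measurable_fun setT gn.
  by apply: measurable_maxr => //; exact: measurable_funN.
have igp : P.-integrable setT (EFin \o (fun w => gp (future X k 0 w))).
  apply: le_integrable ig => //; first by apply/measurable_EFinP; exact: measurableT_comp.
  move=> w _ /=; rewrite lee_fin (ger0_norm (gp0 _)) /gp ge_max normr_ge0 andbT.
  exact: ler_norm.
have ign : P.-integrable setT (EFin \o (fun w => gn (future X k 0 w))).
  apply: le_integrable ig => //; first by apply/measurable_EFinP; exact: measurableT_comp.
  move=> w _ /=; rewrite lee_fin (ger0_norm (gn0 _)) /gn ge_max normr_ge0 andbT.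
  by rewrite -normrN ler_norm.
have fin_ge0 (h : path_space R -> R) : (forall p, 0 <= h p)%R ->
    P.-integrable setT (EFin \o (fun w => h (future X k 0 w))) ->
    \int[P]_w (h (future X k 0 w))%:E < +oo.
  move=> h0 /integrableP[_]; under eq_integral do rewrite gee0_abs ?lee_fin//.
  by [].
have S0 : 0 <= \sum_(m <oo) P (E m) by apply: nneseries_ge0 => m _ _.
have iU (h : path_space R -> R) : (forall p, 0 <= h p)%R -> measurable_fun setT h ->
    P.-integrable setT (EFin \o (fun w => h (future X k 0 w))) ->
    P.-integrable setT (stopped_sum h).
  move=> h0 mh ih; apply/integrableP; split; first exact: measurable_stopped_sum.
  under eq_integral do rewrite gee0_abs ?stopped_sum_ge0//.
  rewrite wald_ge0//; last exact: fin_ge0.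
  apply: lte_mul_pinfty => //; last exact: fin_ge0.
  by rewrite ge0_fin_numE.
transitivity (\int[P]_w (stopped_sum gp w - stopped_sum gn w)).
  apply: ae_eq_integral => //.
  - exact/measurable_EFinP.
  - by apply: emeasurable_funB; exact: measurable_stopped_sum.
  case: fg => N [mN PN0 fgN]; exists N; split => // w /= nfw; apply: fgN => /= -[n [nE fw]].
  apply: nfw => _; rewrite !(stopped_sum_finite _ nE)// fw -EFinB -sumrB.
  by congr (_%:E); apply: eq_bigr => m _.
rewrite (integralB _ (iU _ gp0 mgp igp) (iU _ gn0 mgn ign))//.
rewrite !wald_ge0//; [|exact: fin_ge0|exact: fin_ge0].
rewrite -muleBr//; first last.
- by rewrite fin_num_adde_defl// fin_numN integrable_fin_num.
- by rewrite ge0_fin_numE.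
congr (_ * _); rewrite -integralB_EFin//.
by apply: eq_integral => w _; rewrite gE EFinB.
Qed.

End wald.

Local Close Scope ereal_scope.

(** * Almost sure exit *)

Lemma measurable_cum d (T : measurableType d) (R : realType) (p : T -> nat -> R) t :
  (forall s, measurable_fun setT (p^~ s)) -> measurable_fun setT (fun w => cum (p w) t).
Proof.
move=> mp; elim: t => [|t ih].
  by rewrite (_ : (fun w => _) = cst 0); [exact: measurable_cst|apply/funext => w; rewrite cum0].
rewrite (_ : (fun w => _) = (fun w => cum (p w) t + p w t)).
  exact: measurable_funD.
by apply/funext => w; rewrite cumS.
Qed.

Lemma cumN (R : realType) (p : nat -> R) t : cum (fun s => - p s) t = - cum p t.
Proof. by rewrite /cum sumrN. Qed.

Lemma ler_cum (R : realType) (e : R) (p : nat -> R) n :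
  (forall s, (s < n)%N -> e <= p s) -> e * n%:R <= cum p n.
Proof.
elim: n => [|n ih] h; first by rewrite cum0 mulr0.
rewrite cumS -natr1 mulrDr mulr1 lerD//; last exact: h.
by apply: ih => s sn; apply: h; rewrite (ltn_trans sn).
Qed.

(** If all the sets where [Y >= 1 / (n + 1)] were null, so would be their union, which is the set
    where [Y > 0]. *)
Lemma probability_gt0_ge d (T : measurableType d) (R : realType)
    (P : probability T R) (Y : T -> R) : measurable_fun setT Y ->
  (0 < P [set w | (0 < Y w)%R])%E -> exists2 e : R, 0 < e & (0 < P (Y @^-1` `[e, +oo[))%E.
Proof.
move=> mY; apply: contraPP => /forall2NP nE; apply/negP; rewrite -leNgt.
have mYe (e : R) : measurable (Y @^-1` `[e, +oo[).
  by rewrite -[X in measurable X]setTI; exact: mY.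
rewrite (_ : [set w | 0 < Y w] = \bigcup_n (Y @^-1` `[n.+1%:R^-1, +oo[)).
  rewrite le_eqVlt; apply/orP; left; apply/eqP/negligibleP.
    by apply: bigcup_measurable => n _; exact: mYe.
  apply: negligible_bigcup => n; apply/negligibleP => //.
  have [/negP|/negP] := nE (n.+1%:R^-1); first by rewrite invr_gt0 ltr0n.
  by rewrite -leNgt => h; apply/eqP; rewrite eq_le h measure_ge0.
apply/seteqP; split => [w /= Yw|w [n _ /=]].
  exists (Num.bound (Y w)^-1) => //=; rewrite in_itv/= andbT.
  rewrite invf_ple ?posrE ?ltr0n//.
  have := archi_boundP (ltW (_ : 0 < (Y w)^-1)); rewrite invr_gt0 => /(_ Yw) /ltW h.
  by apply: le_trans h _; rewrite ler_nat.
by rewrite in_itv/= andbT; apply: lt_le_trans; rewrite invr_gt0 ltr0n.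
Qed.

Section exit.
Context {d : measure_display} {Omega : measurableType d} {R : realType} {K : nat}.
Variables (P : probability Omega R) (X : 'I_K -> nat -> Omega -> R).
Hypothesis iidX : iid_process P X.
Variable (D : R).
Hypothesis D0 : 0 < D.

Let mX k s : measurable_fun setT (X k s). Proof. by case: iidX. Qed.

Definition path_of (k : 'I_K) (w : Omega) : nat -> R := fun s => X k s w.

Lemma measurable_past_trunc m k s :
  measurable_fun setT (fun w : g_sigma_algebraType (past_cyl X m) =>
    trunc D m (path_of k w) s).
Proof.
rewrite /trunc; case: ltnP => sm; last exact: measurable_cst.
exact: measurable_past_coord.
Qed.

Lemma past_setb m (b : Omega -> bool) :
  measurable_fun setT (b : g_sigma_algebraType (past_cyl X m) -> bool) ->
  <<s past_cyl X m >> [set w | b w].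
Proof. exact: measurable_setb. Qed.

Definition step_set (V : set R) (N : nat) : set (path_space R) :=
  [set p | forall s, (s < N)%N -> V (p s)].

Lemma measurable_step_set V N : measurable V -> <<s path_cyl R >> (step_set V N).
Proof. by move=> mV; apply: sub_sigma_algebra; exists N, (fun=> V). Qed.

Lemma probability_step_set_gt0 k V N : measurable V -> (0 < P (X k 0 @^-1` V))%E ->
  (0 < P (future X k 0 @^-1` step_set V N))%E.
Proof.
move=> mV PV; case: (iidX) => _ indX idX.
pose A k' (s : nat) := if k' == k then V else setT.
have mA k' s : measurable (A k' s) by rewrite /A; case: ifP.
rewrite (_ : _ @^-1` _ = [set w | forall k' s, (s < N)%N -> A k' s (X k' s w)]).
  rewrite indX//; elim/big_ind : _ => [|x y|k' _]; first exact: lte01.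
    by move=> *; exact: mule_gt0.
  elim/big_ind : _ => [|x y|s _]; first exact: lte01.
    by move=> *; exact: mule_gt0.
  rewrite /A; case: eqP => [->|_]; first by rewrite idX.
  by rewrite preimage_setT probability_setT.
apply/seteqP; split => [w h k' s sN|w h s sN].
  by rewrite /A; case: eqP => // ->; exact: h.
by have := h k s sN; rewrite /A eqxx.
Qed.

Definition exit_set : set (path_space R) := [set p | exists t, exits D (cum p) 0 t].

Lemma measurable_exit_set : <<s path_cyl R >> exit_set.
Proof.
rewrite (_ : exit_set = \bigcup_t [set p : path_space R | exits D (cum p) 0 t]).
  have : measurable (\bigcup_t [set p : path_space R | exits D (cum p) 0 t]) => //.
  apply: bigcup_measurable => t _.
  apply: (@measurable_setb _ (path_space R)).
  apply: (@measurable_exits _ (path_space R) _ _ cum) => s.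
  apply: measurable_cum => i; exact: measurable_coord.
by apply/seteqP; split => [p [t]|p [t _]] pt; exists t.
Qed.

(** On a good path this says [m < t_1]. Being phrased by exits up to [m], it is decided by the past
    on every path, without interference from the default of [first_hit]. *)
Definition never k m : set Omega :=
  [set w | [forall t : 'I_m.+1, ~~ exits D (cum (path_of k w)) 0 t]].

Lemma past_never k m : <<s past_cyl X m >> (never k m).
Proof.
rewrite (_ : never k m =
    [set w | [forall t : 'I_m.+1, ~~ exits D (cum (trunc D m (path_of k w))) 0 t]]).
  apply: past_setb; apply: measurable_fun_setb.
  rewrite (_ : [set w | _] = \bigcap_(t in [set t | (t < m.+1)%N])
      [set w : g_sigma_algebraType (past_cyl X m) |
         ~~ exits D (cum (trunc D m (path_of k w))) 0 t]).
    apply: bigcap_measurableType => t _; apply: measurable_setb.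
    apply: measurable_neg.
    apply: measurable_exits => s.
    by apply: measurable_cum => i; exact: measurable_past_trunc.
  apply/seteqP; split => [w /forallP h t tm|w h]; first exact: (h (Ordinal tm)).
  by apply/forallP => t; apply: h => /=.
apply/funext => w; rewrite /never /mkset; congr (is_true _).
apply/eq_forallb => t; congr (~~ _); rewrite /exits !cum_trunc//.
by rewrite -ltnS.
Qed.

(* Each of the disjoint blocks of [N] steps makes the walk cross the strip with a
   fixed positive probability, independently of the past. *)
Lemma never_exit_prob k V N : measurable V -> (0 < P (X k 0 @^-1` V))%E ->
  (forall p, (forall s, (s < N)%N -> V (p s)) -> D + D <= `|cum p N|) ->
  P (future X k 0 @^-1` (~` exit_set)) = 0%E.
Proof.
move=> mV PV hV.
have mH := measurable_step_set N mV.
pose H := future X k 0 @^-1` step_set V N.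
have mfH : measurable H by exact: (measurable_future_preimage iidX).
have mnH : <<s path_cyl R >> (~` step_set V N).
  by apply: (@measurableC _ (path_space R)).
have PH : (0 < P H)%E by exact: probability_step_set_gt0.
pose r := fine (P (~` H)).
have rE : P (~` H) = r%:E by rewrite fineK// fin_num_measure//; exact: measurableC.
have r0 : 0 <= r by rewrite fine_ge0.
have r1 : r < 1.
  rewrite -lte_fin -rE probability_setC// -{2}(sube0 1%E) lteD2lE//.
  by rewrite lteN2.
have mnever m : measurable (never k m).
  exact: (@past_measurable _ _ _ _ _ _ iidX m _ (@past_never k m)).
have Pn j : (P (never k (j * N)) <= (r ^+ j)%:E)%E.
  elim: j => [|j ih]; first by rewrite expr0 probability_le1.
  (* A walk still inside [(- D, D)] at both ends of the block has moved by less than [D + D], so the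
     steps of the block cannot all lie in [V]. *)
  apply: (@le_trans _ _ (P (never k (j * N) `&` future X k (j * N) @^-1` (~` step_set V N)))).
    apply: le_measure; rewrite ?inE//.
      by apply: measurableI => //; exact: (measurable_future_preimage iidX).
    move=> w /forallP h; split.
      apply/forallP => t; have tN : (t < (j.+1 * N).+1)%N.
        by rewrite (leq_trans (ltn_ord t))// ltnS leq_mul2r leqnSn orbT.
      exact: (h (Ordinal tN)).
    move=> /= hS.
    have within t : (t <= j.+1 * N)%N -> cum (path_of k w) t \in `](- D), D[.
      case: t => [_|t tN]; first by rewrite cum0 in_itv/= oppr_lt0 D0.
      by have := h (Ordinal (tN : (t.+1 < (j.+1 * N).+1)%N)); rewrite /exits/= cum0 subr0 negbK.
    have := hV _ hS; rewrite -[future X k (j * N) w]/(shift (j * N) (path_of k w)).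
    rewrite cum_shift -mulSnr.
    have := within _ (leqnn _); have := within (j * N)%N.
    rewrite leq_mul2r leqnSn orbT => /(_ isT); rewrite !in_itv/=.
    move=> /andP[a1 a2] /andP[b1 b2]; rewrite ler_normr => /orP[]; lra.
  rewrite (markov iidX k (@past_never k (j * N)) mnH) exprSr EFinM.
  by rewrite lee_pmul// -rE preimage_setC.
apply/eqP; rewrite eq_le measure_ge0 andbT.
have mne : measurable (future X k 0 @^-1` (~` exit_set)).
  apply: (measurable_future_preimage iidX).
  by apply: (@measurableC _ (path_space R)); exact: measurable_exit_set.
rewrite -(fineK (fin_num_measure P _ mne)) lee_fin.
have cvr : (GRing.exp r : R ^nat) @ \oo --> (0 : R) by apply: cvg_expr; rewrite ger0_norm.
apply: (ler_cvg_to (cvg_cst _) cvr).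
apply: nearW => j; rewrite -lee_fin fineK ?fin_num_measure//.
apply: le_trans (Pn j); apply: le_measure; rewrite ?inE// => w /= nw.
by apply/forallP => t; apply/negP => e; apply: nw; exists t.
Qed.

Hypothesis EX : forall k, (\int[P]_w (X k 0 w)%:E != 0)%E.

(** A step of nonzero mean is not almost surely 0, so one of the two signs has positive probability;
    steps of that sign and of size at least some [e] then cross the strip. *)
Lemma ae_exit k : P (future X k 0 @^-1` (~` exit_set)) = 0%E.
Proof.
(* The number of steps of size [e] that cover the width of the strip. *)
have block (e : R) : 0 < e -> exists N, D + D <= e * N%:R.
  move=> e0; exists (Num.bound ((D + D) / e)).
  rewrite mulrC -ler_pdivrMr//; apply/ltW/archi_boundP.
  by rewrite divr_ge0 ?addr_ge0 ?ltW.
have [pos|npos] := boolP (0 < P [set w | (0 < X k 0 w)%R])%E.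
  have [e e0 Pe] := probability_gt0_ge (mX k 0) pos.
  have [N eN] := block e e0.
  apply: (@never_exit_prob k `[e, +oo[ N) => // p hp.
  apply: le_trans eN (le_trans _ (ler_norm _)).
  by apply: ler_cum => s /hp; rewrite /= in_itv/= andbT.
have [neg|nneg] := boolP (0 < P [set w | (0 < - X k 0 w)%R])%E.
  have [e e0 Pe] := probability_gt0_ge (measurable_funN (mX k 0)) neg.
  have [N eN] := block e e0.
  apply: (@never_exit_prob k `]-oo, - e] N) => //.
    rewrite (_ : _ @^-1` _ = (\- X k 0) @^-1` `[e, +oo[)//.
    by apply/seteqP; split => w /=; rewrite !in_itv/= andbT lerNr.
  move=> p hp; apply: le_trans eN (le_trans _ (_ : - cum p N <= _)).
    rewrite -cumN; apply: ler_cum => s /hp; rewrite /= in_itv/=; lra.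
  by rewrite -normrN ler_norm.
have /eqP[] := EX k; rewrite -[RHS](@integral0 _ _ _ P setT).
apply: ae_eq_integral => //; first exact/measurable_EFinP.
have mset (f : Omega -> R) : measurable_fun setT f -> measurable [set w | 0 < f w].
  by move=> mf; apply: measurable_setb; exact: measurable_fun_ltr.
have n0 (f : Omega -> R) : measurable_fun setT f ->
    ~~ (0 < P [set w | (0 < f w)%R])%E -> P.-negligible [set w | 0 < f w].
  move=> mf h; apply/negligibleP; first exact: mset.
  by apply/eqP; rewrite eq_le measure_ge0 andbT leNgt.
apply: negligibleS (negligibleU (n0 _ (mX k 0) npos) (n0 _ (measurable_funN (mX k 0)) nneg)).
move=> w /= /not_implyP[_ Xw]; have [Xp|Xn|X0] := ltgtP (X k 0 w) 0.
- by right; rewrite oppr_gt0.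
- by left.
- by case: Xw; rewrite X0.
Qed.

(** Stationarity carries [ae_exit] from time 0 to each [m]; there are countably many pairs of [k]
    and [m]. *)
Lemma ae_good : {ae P, forall w, forall k, good_path D (cum (path_of k w))}.
Proof.
apply: filter_forall => k; apply: ae_foralln => m.
have me : <<s path_cyl R >> (~` exit_set).
  by apply: (@measurableC _ (path_space R)); exact: measurable_exit_set.
exists (future X k m @^-1` (~` exit_set)); split.
- exact: (measurable_future_preimage iidX).
- by have := stationary iidX k m me; rewrite ae_exit.
move=> w /= ne [t et]; apply: ne; exists (m + t)%N.
by rewrite -exits_shift.
Qed.

End exit.

(** * Fusion of the sensors *)

Section fusion_paths.
Context {R : realType} {K : nat}.
Variables (D A B : R) (c : 'I_K -> bool -> R).
Implicit Types L : 'I_K -> nat -> R.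

(** The global statistic as a functional of paths, so that truncated paths can be inserted, with
    arbitrary values [c] assigned to the bits. *)
Definition fstat L (t : nat) : R :=
  \sum_(k < K) \sum_(1 <= n < (samp_count D (L k) t).+1) c k (samp_bit D (L k) n).

Definition fstop L : pred nat :=
  fun t => (0 < t)%N && (fstat L t \notin `](- B), A[).

Definition ftime L : nat := first_hit (fstop L).

Lemma eq_fstop L L' m t : (forall k, good_path D (L k)) ->
  (forall k, good_path D (L' k)) ->
  (forall k s, (s <= m)%N -> L k s = L' k s) -> (t <= m)%N ->
  fstop L' t = fstop L t.
Proof.
move=> gL gL' LL' tm; rewrite /fstop; suff -> : fstat L' t = fstat L t by [].
apply: eq_bigr => k _.
rewrite (eq_samp_count (gL k) (gL' k) (LL' k) tm).
rewrite big_nat [RHS]big_nat; apply: eq_bigr => n /andP[_].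
rewrite ltnS leq_samp_count// => snt.
rewrite /samp_bit (eq_samp_incr (gL k) (gL' k) (LL' k))//.
exact: leq_trans tm.
Qed.

Lemma measurable_fstat d (T : measurableType d) (L : T -> 'I_K -> nat -> R) t :
  (forall k s, measurable_fun setT (fun w => L w k s)) ->
  measurable_fun setT (fun w => fstat (L w) t).
Proof.
move=> mL; rewrite /fstat; elim: (index_enum _) => [|k s ih].
  by under eq_fun do rewrite big_nil; exact: measurable_cst.
under eq_fun do rewrite big_cons; apply: measurable_funD => //.
apply: (@measurable_fun_eval _ _ _ _ (fun w N =>
  \sum_(1 <= n < N.+1) c k (samp_bit D (L w k) n))).
  exact: (@measurable_samp_count _ _ _ D (fun w => L w k)).
move=> N; elim: N => [|N ihN].
  by under eq_fun do rewrite big_geq//; exact: measurable_cst.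
under eq_fun do rewrite big_nat_recr//=; apply: measurable_funD => //.
have -> : (fun w => c k (samp_bit D (L w k) N.+1)) =
    (fun w => if samp_bit D (L w k) N.+1 then c k true else c k false).
  by apply/funext => w; case: ifP.
apply: measurable_fun_ifT; [|exact: measurable_cst|exact: measurable_cst].
exact: (@measurable_samp_bit _ _ _ D (fun w => L w k)).
Qed.

Lemma measurable_fstop d (T : measurableType d) (L : T -> 'I_K -> nat -> R) t :
  (forall k s, measurable_fun setT (fun w => L w k s)) ->
  measurable_fun setT (fun w => fstop (L w) t).
Proof.
move=> mL; apply: measurable_and; first exact: measurable_cst.
apply: measurable_neg.
rewrite (_ : (fun w => _) = (fun w => (- B < fstat (L w) t) && (fstat (L w) t < A))).
  by apply: measurable_and; apply: measurable_fun_ltr => //; exact: measurable_fstat.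
by apply/funext => w; rewrite in_itv.
Qed.

Lemma measurable_ftime d (T : measurableType d) (L : T -> 'I_K -> nat -> R) :
  (forall k s, measurable_fun setT (fun w => L w k s)) ->
  measurable_fun setT (fun w => ftime (L w)).
Proof. by move=> mL; apply: measurable_first_hit => t; exact: measurable_fstop. Qed.

End fusion_paths.

Section fusion.
Context {d : measure_display} {Omega : measurableType d} {R : realType} {K : nat}.
Variables (P : probability Omega R) (X : 'I_K -> nat -> Omega -> R).
Variables (D A B : R) (c : 'I_K -> bool -> R).
Hypothesis iidX : iid_process P X.
Hypothesis D0 : 0 < D.

Let mX k s : measurable_fun setT (X k s). Proof. by case: iidX. Qed.

Local Notation L w := (fun k => cum (path_of X k w)).
Local Notation T w := (ftime D A B c (L w)).
Local Notation NT k w := (samp_count D (L w k) (T w)).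

(* Almost surely: [m] is a sampling time of sensor [k] and [m <= T]. *)
Definition active k m : set Omega :=
  [set w | is_samp D (cum (trunc D m (path_of X k w))) m &&
    [forall t : 'I_m, ~~ fstop D A B c (fun k => cum (trunc D m (path_of X k w))) t]].

Lemma past_active k m : <<s past_cyl X m >> (active k m).
Proof.
apply: past_setb.
have mL k' t : measurable_fun setT (fun w : g_sigma_algebraType (past_cyl X m) =>
    cum (trunc D m (path_of X k' w)) t).
  by apply: measurable_cum => i; exact: measurable_past_trunc.
apply: measurable_and.
  exact: (@measurable_is_samp _ _ _ D (fun w : g_sigma_algebraType (past_cyl X m) =>
    cum (trunc D m (path_of X k w)))).
apply: measurable_fun_setb.
rewrite (_ : [set w | _] = \bigcap_(t in [set t | (t < m)%N])
    [set w : g_sigma_algebraType (past_cyl X m) |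
       ~~ fstop D A B c (fun k => cum (trunc D m (path_of X k w))) t]).
  apply: bigcap_measurableType => t _; apply: measurable_setb.
  apply: measurable_neg; exact: measurable_fstop.
apply/seteqP; split => [w /forallP h t tm|w h]; first exact: (h (Ordinal tm)).
by apply/forallP => t; apply: h => /=.
Qed.

(** The true and the truncated paths agree up to [m], which decides both whether [m] is a sampling
    time and whether the test stops before [m]. *)
Lemma activeP k m w : (forall k, good_path D (L w k)) ->
  (exists t, fstop D A B c (L w) t) ->
  active k m w <-> is_samp D (L w k) m /\ (m <= T w)%N.
Proof.
move=> gL ex; have gt k' : good_path D (cum (trunc D m (path_of X k' w))).
  exact: good_path_trunc.
have LL k' s : (s <= m)%N -> L w k' s = cum (trunc D m (path_of X k' w)) s.
  by move=> sm; rewrite cum_trunc.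
have [sT minT] := first_hitP ex.
have es := eq_is_samp (gL k) (gt k) (LL k).
have ef := eq_fstop A B c gL gt LL.
rewrite /active /= es; split => [/andP[-> /forallP h]|[-> mT]].
  split=> //; rewrite leqNgt; apply/negP => Tm.
  by have := h (Ordinal Tm); rewrite ef ?(ltnW Tm)// sT.
apply/forallP => t; rewrite ef; last exact/ltnW.
by apply: minT; exact: leq_trans (ltn_ord t) mT.
Qed.

Lemma sum_active (g : path_space R -> R) k w : (forall k, good_path D (L w k)) ->
  (exists t, fstop D A B c (L w) t) ->
  (forall m, ((T w).+1 <= m)%N -> ~ active k m w) /\
  \sum_(m < (T w).+1 | w \in active k m) g (future X k m w) =
  \sum_(n < (NT k w).+1) g (shift (samp_time D (L w k) n) (path_of X k w)).
Proof.
move=> gL ex; split => [m Tm /(activeP k m gL ex)[_]|]; first by rewrite leqNgt Tm.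
rewrite -(sum_is_samp (fun m => g (shift m (path_of X k w))) (T w) (gL k)).
apply: eq_bigl => m; apply/idP/idP => [/set_mem /(activeP k m gL ex)[]//|sm].
by apply/mem_set/(activeP k m gL ex); split => //; rewrite -ltnS.
Qed.

Hypothesis gX : {ae P, forall w, forall k, good_path D (L w k)}.
Hypothesis exT : {ae P, forall w, exists t, fstop D A B c (L w) t}.
Hypothesis iT : P.-integrable setT (EFin \o (fun w => (T w)%:R : R)).

(* [E[N^k_T + 1]] *)
Definition mean_samples k : \bar R := (\sum_(m <oo) P (active k m))%E.

Lemma mean_samplesE k : (\int[P]_w stopped_sum X k (active k) (fun=> 1%R) w)%E = mean_samples k.
Proof.
have i1 : (\int[P]_(w in setT) (1%R : R)%:E = 1)%E.
  by rewrite integral_cst// mul1e; exact: probability_setT.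
by rewrite (wald_ge0 iidX (@past_active k))// i1 ?mule1// ltry.
Qed.

(** At most one block starts at each of the instants from 0 to [T], so the count is at most [T + 1],
    which is integrable. *)
Lemma mean_samples_lty k : (mean_samples k < +oo)%E.
Proof.
rewrite -mean_samplesE; pose U w : \bar R := ((T w)%:R + 1)%:E.
have iU : P.-integrable setT U.
  rewrite (_ : U = (EFin \o (fun w => (T w)%:R : R)) \+ cst 1%E)%E//.
  by apply: integrableD => //; exact: finite_measure_integrable_cst.
apply: (@le_lt_trans _ _ (\int[P]_w U w)%E); last first.
  have /integrableP[_] := iU; under eq_integral do rewrite gee0_abs ?lee_fin ?addr_ge0//.
  by [].
apply: ae_ge0_le_integral => //.
- by move=> w _; apply: stopped_sum_ge0 => p.
- exact: (measurable_stopped_sum iidX k (@past_active k)).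
- by move=> w _; rewrite lee_fin addr_ge0.
- exact: measurable_int iU.
near=> w => _; have gw : forall k, good_path D (L w k) by near: w.
have ew : exists t, fstop D A B c (L w) t by near: w.
have [nE _] := sum_active (fun=> 1%R) k gw ew.
rewrite (stopped_sum_finite X k _ nE)//.
rewrite /U lee_fin natr1 big_mkcond /=.
apply: (@le_trans _ _ (\sum_(m < (T w).+1) 1)); last by rewrite sumr_const card_ord.
by apply: ler_sum => m _; case: ifP.
Unshelve. all: by end_near. Qed.

(** Instant 0 is active on every path. *)
Lemma mean_samples_ge1 k : (1 <= mean_samples k)%E.
Proof.
rewrite /mean_samples (nneseries_split 0 1)// big_nat1 (_ : active k 0 = setT).
  by rewrite probability_setT leeDl// nneseries_ge0.
apply/seteqP; split => // w _; apply/andP; split; last by apply/forallP => -[].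
by apply/existsP; exists ord0.
Qed.

Lemma wald_samples k (g : path_space R -> R) (f : Omega -> R) :
  measurable_fun setT g -> measurable_fun setT f ->
  P.-integrable setT (EFin \o (fun w => g (future X k 0 w))) ->
  {ae P, forall w, (forall k, good_path D (L w k)) ->
    f w = \sum_(n < (NT k w).+1) g (shift (samp_time D (L w k) n) (path_of X k w))} ->
  (\int[P]_w (f w)%:E = mean_samples k * \int[P]_w (g (future X k 0 w))%:E)%E.
Proof.
move=> mg mf ig fg; apply: (wald iidX (@past_active k) (mean_samples_lty k)) => //.
near=> w; have gw : forall k, good_path D (L w k) by near: w.
have ew : exists t, fstop D A B c (L w) t by near: w.
have [nE sE] := sum_active g k gw ew.
exists (T w).+1; split => //; rewrite sE.
have : (forall k, good_path D (L w k)) -> f w =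
    \sum_(n < (NT k w).+1) g (shift (samp_time D (L w k) n) (path_of X k w)) by near: w.
exact.
Unshelve. all: by end_near. Qed.

End fusion.

Lemma measurable_natr d (T : measurableType d) (R : realType) (N : T -> nat) :
  measurable_fun setT N -> measurable_fun setT (fun w => (N w)%:R : R).
Proof.
by move=> mN; apply: (@measurable_fun_eval _ _ _ _ (fun _ n => n%:R : R)) => // n;
  exact: measurable_cst.
Qed.

Lemma measurable_path_cum (R : realType) t :
  measurable_fun setT (fun p : path_space R => cum p t).
Proof. by apply: measurable_cum => s; exact: measurable_coord. Qed.

(** * Wald's identity for the first block, the sampling times and the bits *)

Section wald_identities.
Context {d : measure_display} {Omega : measurableType d} {R : realType} {K : nat}.
Variables (P : probability Omega R) (X : 'I_K -> nat -> Omega -> R).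
Variables (D A B : R) (c : 'I_K -> bool -> R).
Hypothesis iidX : iid_process P X.
Hypothesis D0 : 0 < D.

Let mX k s : measurable_fun setT (X k s). Proof. by case: iidX. Qed.

Local Notation L w := (fun k => cum (path_of X k w)).
Local Notation T w := (ftime D A B c (L w)).
Local Notation NT k w := (samp_count D (L w k) (T w)).

Let mL k t : measurable_fun setT (fun w => L w k t).
Proof. by apply: measurable_cum => s; exact: mX. Qed.

Hypothesis gX : {ae P, forall w, forall k, good_path D (L w k)}.

Local Notation tau k := (fun w => (samp_time D (L w k) 1)%:R : R).

Let mtau k : measurable_fun setT (tau k).
Proof. by apply: measurable_natr; exact: (@measurable_samp_time _ _ _ D (fun w => L w k)). Qed.

Lemma neverP k m w : good_path D (L w k) ->
  never X D k m w <-> (m < samp_time D (L w k) 1)%N.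
Proof.
move=> gw; have [ex minex] := samp_time_exits 0 gw.
split=> [/forallP h|mt]; last first.
  by apply/forallP => t; apply: minex; apply: leq_ltn_trans mt; rewrite -ltnS.
rewrite ltnNge; apply/negP => tm.
by case/negP: (h (Ordinal (tm : (_ < m.+1)%N))); exact: ex.
Qed.

(** The tail formula for the mean of [t_1], obtained as Wald's identity with [g = 1]. *)
Lemma sum_never k : P.-integrable setT (EFin \o tau k) ->
  (\sum_(m <oo) P (never X D k m) = \int[P]_w (tau k w)%:E)%E.
Proof.
move=> itau; have i1 : (\int[P]_(w in setT) (1%R : R)%:E = 1)%E.
  by rewrite integral_cst// mul1e; exact: probability_setT.
have := wald_ge0 iidX (k := k) (@past_never _ _ _ _ X D k) (g := fun=> 1) (measurable_cst _).
rewrite i1 mule1 => <- //; last by rewrite ltry.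
apply: ae_eq_integral => //.
- exact: (measurable_stopped_sum iidX k (@past_never _ _ _ _ X D k)).
- exact/measurable_EFinP.
apply: filterS gX => w gw _; have gk := gw k.
rewrite (stopped_sum_finite X k (n := samp_time D (L w k) 1))//; last first.
  by move=> m tm /(neverP _ gk); rewrite ltnNge tm.
congr EFin; rewrite (eq_bigl xpredT) ?sumr_const ?card_ord// => m.
by apply/mem_set/neverP.
Qed.

(** The step taken after instant [m] contributes exactly when [m < t_1], so [g] reads the first
    coordinate of the future. *)
Lemma wald_incr k : P.-integrable setT (EFin \o tau k) ->
  P.-integrable setT (EFin \o X k 0) ->
  (\int[P]_w (samp_incr D (L w k) 1)%:E =
   \int[P]_w (tau k w)%:E * \int[P]_w (X k 0 w)%:E)%E.
Proof.
move=> itau iX; rewrite -sum_never//.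
apply: (wald iidX (@past_never _ _ _ _ X D k) _ (g := fun p => p 0%N)) => //.
- rewrite sum_never//; have /integrableP[_] := itau.
  by under eq_integral do rewrite gee0_abs ?lee_fin//.
- exact: measurable_coord.
- exact: (@measurable_samp_incr _ _ _ D (fun w => L w k)).
apply: filterS gX => w gw; have gk := gw k.
exists (samp_time D (L w k) 1); split.
  by move=> m tm /(neverP _ gk); rewrite ltnNge tm.
rewrite /samp_incr cum0 subr0 /cum; symmetry.
rewrite (eq_bigl xpredT); first by apply: eq_bigr => m _; rewrite /future addn0.
by move=> m; apply/mem_set/neverP.
Qed.

Hypothesis exT : {ae P, forall w, exists t, fstop D A B c (L w) t}.
Hypothesis iT : P.-integrable setT (EFin \o (fun w => (T w)%:R : R)).

Local Notation next k := (fun w => (samp_time D (L w k) (NT k w).+1)%:R : R).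

Let mT : measurable_fun setT (fun w => T w).
Proof. by apply: measurable_ftime => k s; exact: mL. Qed.

Let mNT k : measurable_fun setT (fun w => NT k w).
Proof.
apply: (@measurable_fun_eval _ _ _ _ (fun w t => samp_count D (L w k) t)) => // t.
exact: (@measurable_samp_count _ _ _ D (fun w => L w k)).
Qed.

(** [t_1] is dominated by the first sampling time after [T], whose integrability comes from that of
    [T] and [Y_k]. *)
Lemma integrable_tau k : P.-integrable setT (EFin \o next k) ->
  P.-integrable setT (EFin \o tau k).
Proof.
move=> inext; apply/integrableP; split; first exact/measurable_EFinP.
have /integrableP[mnext] := inext; apply: le_lt_trans.
apply: ae_ge0_le_integral => //.
- by apply: measurableT_comp => //; exact/measurable_EFinP.
- exact: measurableT_comp.
apply: filterS gX => w gw _.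
have h : tau k w <= next k w by rewrite ler_nat leq_samp_time.
by change (`|(tau k w)%:E| <= `|(next k w)%:E|)%E; rewrite !gee0_abs ?lee_fin.
Qed.

Lemma wald_time k : P.-integrable setT (EFin \o next k) ->
  (\int[P]_w (next k w)%:E = mean_samples P X D A B c k * \int[P]_w (tau k w)%:E)%E.
Proof.
move=> inext.
apply: (wald_samples iidX D0 gX exT iT (g := fun p => (samp_time D (cum p) 1)%:R)).
- apply: measurable_natr; apply: measurable_samp_time => t.
  exact: measurable_path_cum.
- by have /measurable_int/measurable_EFinP := inext.
- exact: integrable_tau.
by apply: aeW => w gw; rewrite -natr_sum sum_interarrival.
Qed.

Let measurable_bit_value k n :
  measurable_fun setT (fun w => c k (samp_bit D (L w k) n)).
Proof.
rewrite (_ : (fun w => _) = (fun w => if samp_bit D (L w k) n then c k true else c k false)).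
  apply: measurable_fun_ifT; [|exact: measurable_cst|exact: measurable_cst].
  exact: (@measurable_samp_bit _ _ _ D (fun w => L w k)).
by apply/funext => w; case: ifP.
Qed.

(** Each bit contributes at most [C] in absolute value, and at most [T] bits have been sent by time
    [T]. *)
Lemma integrable_stat k : P.-integrable setT (EFin \o (fun w =>
  \sum_(1 <= n < (NT k w).+1) c k (samp_bit D (L w k) n))).
Proof.
pose C := `|c k true| + `|c k false|.
have mstat : measurable_fun setT (fun w =>
    \sum_(1 <= n < (NT k w).+1) c k (samp_bit D (L w k) n)).
  apply: (@measurable_fun_eval _ _ _ _ (fun w N =>
    \sum_(1 <= n < N.+1) c k (samp_bit D (L w k) n))) => // N.
  elim: N => [|N ih]; first by under eq_fun do rewrite big_geq//; exact: measurable_cst.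
  by under eq_fun do rewrite big_nat_recr//=; exact: measurable_funD.
apply: (le_integrable _ _ _ (integrableZl _ C iT)) => //.
  exact/measurable_EFinP.
move=> w _ /=; rewrite lee_fin (le_trans (ler_norm_sum _ _ _))//.
apply: (@le_trans _ _ (\sum_(1 <= n < (NT k w).+1) C)).
  apply: ler_sum => n _; rewrite /C; case: samp_bit; first by rewrite lerDl.
  by rewrite lerDr.
rewrite sumr_const_nat subn1/= normrM -[X in X <= _]mulr_natr ler_pM//.
- by rewrite /C addr_ge0.
- by rewrite ger0_norm// /C addr_ge0.
rewrite ger0_norm// ler_nat; apply/bigmax_leqP => n _.
by rewrite -ltnS.
Qed.

Lemma wald_stat k :
  P.-integrable setT (EFin \o (fun w => c k (samp_bit D (L w k) 1))) ->
  (\int[P]_w (\sum_(1 <= n < (NT k w).+1) c k (samp_bit D (L w k) n) +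
              c k (samp_bit D (L w k) (NT k w).+1))%:E =
   mean_samples P X D A B c k * \int[P]_w (c k (samp_bit D (L w k) 1))%:E)%E.
Proof.
move=> ic.
apply: (wald_samples iidX D0 gX exT iT (g := fun p => c k (samp_bit D (cum p) 1))) => //.
- rewrite (_ : (fun p => _) =
      (fun p : path_space R => if samp_bit D (cum p) 1 then c k true else c k false)).
    apply: measurable_fun_ifT; [|exact: measurable_cst|exact: measurable_cst].
    by apply: measurable_samp_bit => t; exact: measurable_path_cum.
  by apply/funext => p; case: ifP.
- apply: measurable_funD.
    by have /measurable_int/measurable_EFinP := integrable_stat k.
  exact: (@measurable_fun_eval _ _ _ _ (fun w N => c k (samp_bit D (L w k) N.+1))).
apply: aeW => w gw; rewrite -(big_nat_recr _ _ (fun n => c k (samp_bit D (L w k) n)))//.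
rewrite big_add1/= big_mkord; apply: eq_bigr => n _.
by rewrite /samp_bit samp_incrS_shift.
Qed.

End wald_identities.

(** * The first bit *)

Lemma samp_incr1 (R : realType) (D : R) p :
  samp_incr D (cum p) 1 = cum p (samp_time D (cum p) 1).
Proof. by rewrite -[RHS]subr0 -(cum0 p). Qed.

Section first_bit.
Context {d : measure_display} {Omega : measurableType d} {R : realType} {K : nat}.
Variables (P : probability Omega R) (X : 'I_K -> nat -> Omega -> R) (D : R).
Hypothesis iidX : iid_process P X.
Hypothesis D0 : 0 < D.

Let mX k s : measurable_fun setT (X k s). Proof. by case: iidX. Qed.

Local Notation bit k := (fun w => samp_bit D (cum (path_of X k w)) 1).

Lemma first_exit_le (L : nat -> R) n : exits D L 0 n ->
  (0 < samp_time D L 1 <= n)%N.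
Proof.
move=> en; have [/andP[t0 _] mint] := first_hitP (ex_intro _ n en).
apply/andP; split=> //; rewrite leqNgt; apply/negP => nt.
by have := mint _ nt; rewrite en.
Qed.

Let measurable_bit k : measurable_fun setT (bit k).
Proof.
apply: (@measurable_samp_bit _ _ _ D (fun w => cum (path_of X k w))) => t.
by apply: measurable_cum => s; exact: mX.
Qed.

Let block (e : R) : 0 < e -> exists N, D <= e * N%:R.
Proof.
move=> e0; exists (Num.bound (D / e)).
rewrite mulrC -ler_pdivrMr//; apply/ltW/archi_boundP.
by rewrite divr_ge0 ?ltW.
Qed.

Let pos_exits (e : R) N (p : nat -> R) : 0 < e -> D <= e * N%:R ->
  (forall s, (s < N)%N -> e <= p s) -> exits D (cum p) 0 N.
Proof.
move=> e0 eN hp; have DN : D <= cum p N by exact/(le_trans eN)/ler_cum.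
rewrite /exits lt0n; apply/andP; split.
  by apply/eqP => N0; move: eN; rewrite N0 mulr0 leNgt D0.
by rewrite cum0 subr0 in_itv/= negb_and -!leNgt DN orbT.
Qed.

(** When the first [N] steps are all at least [e], the walk exits by time [N] and is positive at
    that moment. A step set of this kind has positive probability. *)
Lemma bit_pos k : (0 < P [set w | (0 < X k 0 w)%R] -> 0 < P [set w | bit k w])%E.
Proof.
move=> pos; have [e e0 Pe] := probability_gt0_ge (mX k 0) pos.
have [N eN] := block e0.
apply: lt_le_trans (probability_step_set_gt0 iidX N _ Pe) _ => //.
apply: le_measure; rewrite ?inE.
- apply: (measurable_future_preimage iidX); exact: measurable_step_set.
- exact: measurable_setb.
move=> w; set p := path_of X k w => hp.
have {}hp s : (s < N)%N -> e <= p s by move=> /hp; rewrite /= in_itv/= andbT.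
have /andP[t0 tN] := first_exit_le (pos_exits e0 eN hp).
rewrite /mkset /samp_bit samp_incr1.
apply: lt_le_trans (ler_cum (e := e) _); first by rewrite mulr_gt0// ltr0n.
by move=> s st; apply: hp; exact: leq_trans tN.
Qed.

Lemma bit_neg k : (0 < P [set w | (X k 0 w < 0)%R] -> 0 < P [set w | ~~ bit k w])%E.
Proof.
move=> neg.
have neg' : (0 < P [set w | (0 < (\- X k 0) w)%R])%E.
  by rewrite (_ : mkset _ = [set w | X k 0 w < 0])//; apply/seteqP; split => w /=; rewrite oppr_gt0.
have [e e0 Pe] := probability_gt0_ge (measurable_funN (mX k 0)) neg'.
have [N eN] := block e0.
have Pe' : (0 < P (X k 0 @^-1` `]-oo, (- e)%R]))%E.
  rewrite (_ : _ @^-1` _ = (\- X k 0) @^-1` `[e, +oo[)//.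
  by apply/seteqP; split => w /=; rewrite !in_itv/= andbT lerNr.
apply: lt_le_trans (probability_step_set_gt0 iidX N _ Pe') _ => //.
apply: le_measure; rewrite ?inE.
- apply: (measurable_future_preimage iidX); exact: measurable_step_set.
- by apply: measurable_setb; exact: measurable_neg.
move=> w; set p := path_of X k w => hp.
have {}hp s : (s < N)%N -> e <= - p s by move=> /hp; rewrite /= in_itv/= lerNr.
have ex : exits D (cum p) 0 N.
  have := pos_exits e0 eN hp; rewrite /exits cumN !cum0 !subr0 !in_itv/=.
  move=> /andP[-> /=]; rewrite !negb_and -!leNgt => /orP[] h; apply/orP.
    by right; lra.
  by left; lra.
have /andP[t0 tN] := first_exit_le ex.
rewrite /mkset /samp_bit samp_incr1 -leNgt -oppr_ge0 -cumN.
apply: le_trans (ler_cum (e := e) _); first by rewrite mulr_ge0// ltW.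
by move=> s st; apply: hp; exact: leq_trans tN.
Qed.

Let ae_path k (V : set R) : measurable V -> P (X k 0 @^-1` V) = 0%E ->
  {ae P, forall w, forall s, ~ V (path_of X k w s)}.
Proof.
move=> mV V0; apply: ae_foralln => s; exists (X k s @^-1` V); split.
- by rewrite -[X in measurable X]setTI; exact: mX.
- by case: iidX => _ _ idX; have := idX k s V mV; rewrite V0.
- by move=> w /= /contrapT.
Qed.

(** Without positive steps the walk stays at or below 0. Paths that never exit cause no trouble
    here: the default sampling time 0 gives a zero increment, hence the bit [false]. *)
Lemma bit_pos0 k : P [set w | (0 < X k 0 w)%R] = 0%E -> P [set w | bit k w] = 0%E.
Proof.
move=> p0; apply/negligibleP; first exact: measurable_setb.
have : P (X k 0 @^-1` `]0, +oo[) = 0%E.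
  rewrite -[RHS]p0; congr (P _); apply/seteqP; by split => w /=; rewrite in_itv/= andbT.
move=> /(ae_path (measurable_itv _)) aV; apply: negligibleS aV => w /= bw nV.
move: bw; rewrite /mkset /samp_bit samp_incr1.
apply/negP; rewrite -leNgt -oppr_ge0 -cumN.
apply: le_trans (ler_cum (e := 0) _); first by rewrite mul0r.
by move=> s _; rewrite oppr_ge0 leNgt; apply/negP => h; apply: (nV s); rewrite in_itv/= andbT.
Qed.

(** Unlike for the positive bit, almost sure exit is assumed, since the default on a path that never
    exits is precisely the bit [false]. *)
Lemma bit_neg0 k : {ae P, forall w, good_path D (cum (path_of X k w))} ->
  P [set w | (X k 0 w < 0)%R] = 0%E -> P [set w | ~~ bit k w] = 0%E.
Proof.
move=> gX p0; apply/negligibleP; first by apply: measurable_setb; exact: measurable_neg.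
have : P (X k 0 @^-1` `]-oo, 0[) = 0%E.
  rewrite -[RHS]p0; congr (P _); apply/seteqP; by split => w /=; rewrite in_itv/=.
move=> /(ae_path (measurable_itv _)) aV; have aI : {ae P, forall w, good_path D (cum (path_of X k w)) /\
    forall s, ~ (`]-oo, 0[%classic : set R) (path_of X k w s)} by exact: filterI.
apply: negligibleS aI => w /= bw [gw nV]; move: bw; apply/negP; rewrite negbK.
have [/andP[t0 ex] _] := samp_time_exits 0 gw.
move: ex; rewrite -[X in cum _ X - _]/(samp_time D (cum (path_of X k w)) 1).
rewrite -[X in _ - cum _ X]/0%N cum0 subr0 in_itv/= negb_and -!leNgt.
rewrite /mkset /samp_bit samp_incr1.
have c0 : 0 <= cum (path_of X k w) (samp_time D (cum (path_of X k w)) 1).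
  apply: le_trans (ler_cum (e := 0) _); first by rewrite mul0r.
  by move=> s _; rewrite leNgt; apply/negP => h; apply: (nV s); rewrite in_itv.
by move=> /orP[]; [move: c0 D0|move: D0]; set u := cum _ _; lra.
Qed.

End first_bit.

(** * Log-likelihood ratios and relative entropy *)

Lemma measurable_inv_ge0 d (T : measurableType d) (R : realType) (g : T -> R) :
  measurable_fun setT g -> (forall x, 0 <= g x) ->
  measurable_fun setT (fun x => (g x)^-1).
Proof.
move=> mg g0; have -> : (fun x => (g x)^-1) = (fun x => g x `^ (-1)).
  by apply/funext => x; rewrite powR_inv1.
exact: (measurableT_comp (measurable_powR (-1)) mg).
Qed.

Section llr.
Context {d dY : measure_display} {Omega : measurableType d} {Y : measurableType dY}
  {R : realType} {K : nat}.
Variables (P : bool -> probability Omega R) (y : 'I_K -> nat -> Omega -> Y)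
  (mu : 'I_K -> {measure set Y -> \bar R}) (f : bool -> 'I_K -> Y -> R).
Hypothesis hy_meas : forall k s, measurable_fun setT (y k s).
Hypothesis hf_meas : forall i k, measurable_fun setT (f i k).
Hypothesis hf_ge0 : forall i k x, 0 <= f i k x.
Hypothesis hy_dens : forall i k s (S : set Y), measurable S ->
  P i (y k s @^-1` S) = (\int[mu k]_(x in S) (f i k x)%:E)%E.
Hypothesis hy_indep : forall i,
  mutually_independent (P i) (fun ks : 'I_K * nat => y ks.1 ks.2).

Let h k v := ln (f true k v / f false k v).

Let mh k : measurable_fun setT (h k).
Proof.
apply: (measurableT_comp (@measurable_ln R)).
by apply: measurable_funM => //; apply: measurable_inv_ge0.
Qed.

Let mhV k (V : set R) : measurable V -> measurable (h k @^-1` V).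
Proof. by move=> mV; rewrite -[X in measurable X]setTI; exact: mh. Qed.

Lemma iid_llr i : iid_process (P i) (llr y f).
Proof.
split.
- by move=> k s; apply: (measurableT_comp (mh k)).
- move=> N A mA.
  pose J := [fset ks in [seq (k, s) | k <- enum 'I_K, s <- iota 0 N]]%fset.
  have inJ k s : ((k, s) \in J) = (s < N)%N.
    rewrite inE /=; apply/allpairsP/idP => [[[k' s'] /= [_]]|sN].
      by rewrite mem_iota => /andP[_ ?] [_ ->].
    by exists (k, s); rewrite /= mem_enum mem_iota.
  have := @hy_indep i J (fun ks => h ks.1 @^-1` A ks.1 ks.2) (fun j _ => mhV j.1 (mA j.1 j.2)).
  rewrite -bigcap_fset => e.
  transitivity (P i (\bigcap_(ks in [set ks | ks \in J])
      (y ks.1 ks.2 @^-1` (h ks.1 @^-1` A ks.1 ks.2)))).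
    congr (P i _); apply/seteqP; split => [w hw [k s] /=|w hw k s sN].
      by rewrite inJ => sN; exact: hw.
    by apply: (hw (k, s)) => /=; rewrite inJ.
  rewrite e (perm_big [seq (k, s) | k <- enum 'I_K, s <- iota 0 N]).
    rewrite big_allpairs_dep/= big_enum/=; apply: eq_bigr => k _.
    by rewrite -{1}(subn0 N) big_mkord.
  apply: uniq_perm; first exact: fset_uniq.
    by apply: allpairs_uniq; rewrite ?enum_uniq ?iota_uniq// => -[? ?] [? ?].
  by move=> ks; rewrite inE.
- move=> k s V mV.
  rewrite -[_ @^-1` _]/(y k s @^-1` (h k @^-1` V)).
  rewrite -[X in _ = P i X]/(y k 0%N @^-1` (h k @^-1` V)).
  by rewrite !hy_dens//; exact: mhV.
Qed.

(* The singular parts of the two laws are sent to 0 by [x / 0 = 0] and [ln 0 = 0];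
   away from 0 both laws of the log-likelihood ratio are equivalent. *)
Lemma llr_null i j k (V : set R) : measurable V -> ~ V 0 ->
  P i (llr y f k 0 @^-1` V) = 0%E -> P j (llr y f k 0 @^-1` V) = 0%E.
Proof.
move=> mV V0.
have e n : P n (llr y f k 0 @^-1` V) =
    (\int[mu k]_(x in h k @^-1` V) (f n k x)%:E)%E.
  by rewrite -(hy_dens n k 0%N)//; exact: mhV.
rewrite !e => fi0.
have mS : measurable (h k @^-1` V) by exact: mhV.
have : (\int[mu k]_(x in h k @^-1` V) `|(f i k x)%:E| = 0)%E.
  by rewrite -[RHS]fi0; apply: eq_integral => x _; rewrite gee0_abs ?lee_fin.
have mfE n : measurable_fun (h k @^-1` V) (EFin \o f n k).
  by apply: measurable_funTS; exact/measurable_EFinP.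
move=> /(ae_eq_integral_abs (mu k) mS (mfE i)) ae0.
apply: null_set_integral => //; first exact: mfE.
apply/negligibleP => //.
apply: negligibleS ae0 => x /= Vx; apply/not_implyP; split => // /eqP.
rewrite eqe => /eqP fx; apply: V0; move: Vx; rewrite /h.
by case: i fx {fi0} => ->; rewrite ?mul0r ?invr0 ?mulr0 ln0.
Qed.

End llr.

Section relative_entropy.
Context {R : realType}.

Lemma ln_lt_sub1 (x : R) : 0 < x -> x != 1 -> ln x < x - 1.
Proof.
move=> x0 x1; rewrite ltrBrDl -[ltRHS](lnK (x := x)) ?posrE//.
by apply: expR_gt1Dx; rewrite ln_eq0.
Qed.

Lemma ln_le_sub1 (x : R) : 0 < x -> ln x <= x - 1.
Proof.
by move=> x0; have [->|/(ln_lt_sub1 x0)/ltW//] := eqVneq x 1; rewrite ln1 subrr.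
Qed.

(** This is [ln x <= x - 1] at [x = q / p]. The lower bound is linear, so the bounds for the two
    outcomes of a bit add up to 0. *)
Lemma mul_ln_div (p q : R) : 0 < p -> 0 < q -> p - q <= p * ln (p / q) ?= iff (p == q).
Proof.
move=> p0 q0; have qp0 : 0 < q / p by rewrite divr_gt0.
have -> : ln (p / q) = - ln (q / p) by rewrite -lnV ?posrE// invf_div.
have e : p - q = p * - (q / p - 1).
  by rewrite mulrN mulrBr mulr1 mulrCA (divff (lt0r_neq0 p0)) mulr1 opprB.
split; first by rewrite e ler_pM2l// lerN2 ln_le_sub1.
have [->|pq] := eqVneq p q; first by rewrite subrr (divff (lt0r_neq0 q0)) ln1 oppr0 mulr0 eqxx.
apply/negbTE; rewrite lt_eqF// e ltr_pM2l// ltrN2 ln_lt_sub1//.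
by apply: contra pq => /eqP h; rewrite eq_sym -[q](divfK (lt0r_neq0 p0)) h mul1r.
Qed.

(* The hypotheses on [p] and [q] exclude the cases where [x / 0 = 0] or [ln 0 = 0]
   would replace an infinite value. *)
Lemma relative_entropy_ge0 (p q : R) : 0 <= p <= 1 -> 0 <= q <= 1 ->
  (p = 0 <-> q = 0) -> (p = 1 <-> q = 1) ->
  0 <= p * ln (p / q) + (1 - p) * ln ((1 - p) / (1 - q)) /\
  (p * ln (p / q) + (1 - p) * ln ((1 - p) / (1 - q)) = 0 ->
   ln (p / q) = 0 /\ ln ((1 - p) / (1 - q)) = 0).
Proof.
move=> /andP[p0 p1] /andP[q0 q1] pq0 pq1.
have [pe|pn0] := eqVneq p 0.
  by rewrite pe (pq0.1 pe) !mul0r subr0 divr1 ln1 ln0// mulr0 addr0.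
have [pe|pn1] := eqVneq p 1.
  by rewrite pe (pq1.1 pe) !subrr mul0r divr1 ln1 ln0// mulr0 !mul0r addr0.
have qn0 : q != 0 by apply: contra pn0 => /eqP /pq0 ->.
have qn1 : q != 1 by apply: contra pn1 => /eqP /pq1 ->.
have {}p0 : 0 < p by rewrite lt_neqAle eq_sym pn0.
have {}q0 : 0 < q by rewrite lt_neqAle eq_sym qn0.
have {}p1 : 0 < 1 - p by rewrite subr_gt0 lt_neqAle pn1.
have {}q1 : 0 < 1 - q by rewrite subr_gt0 lt_neqAle qn1.
have [h1 h1e] := mul_ln_div p0 q0; have [h2 h2e] := mul_ln_div p1 q1.
split; first lra.
(* A zero sum forces equality in both bounds, hence [p = q]. *)
move=> h0; have /eqP : p - q = p * ln (p / q) by lra.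
rewrite h1e => /eqP ->; rewrite (divff (lt0r_neq0 q0)) (divff (lt0r_neq0 q1)).
by rewrite ln1.
Qed.

End relative_entropy.

(** * The delay formula *)

Lemma expectationE d (T : measurableType d) (R : realType) (P : probability T R)
    (Z : T -> R) : ('E_P[Z] = \int[P]_w (Z w)%:E)%E.
Proof. by rewrite unlock. Qed.

Lemma fine_expectationD d (T : measurableType d) (R : realType)
    (P : probability T R) (Z1 Z2 : T -> R) :
  P.-integrable setT (EFin \o Z1) -> P.-integrable setT (EFin \o Z2) ->
  fine 'E_P[fun w => Z1 w + Z2 w] = fine 'E_P[Z1] + fine 'E_P[Z2].
Proof.
move=> i1 i2; rewrite !expectationE; under eq_integral do rewrite EFinD.
by rewrite integralD// fineD// integrable_fin_num.
Qed.

Lemma fine_expectation_sum d (T : measurableType d) (R : realType)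
    (P : probability T R) K (Z : 'I_K -> T -> R) :
  (forall k, P.-integrable setT (EFin \o Z k)) ->
  fine 'E_P[fun w => \sum_(k < K) Z k w] = \sum_(k < K) fine 'E_P[Z k].
Proof.
move=> iZ; rewrite expectationE; under eq_integral do rewrite -sumEFin.
rewrite (@integral_sum _ _ _ P setT measurableT _ (fun k => EFin \o Z k))//.
under [RHS]eq_bigr do rewrite expectationE.
by rewrite sum_fine// => k _; exact: (integrable_fin_num measurableT (iZ k)).
Qed.

Lemma fine_expectation_if d (T : measurableType d) (R : realType)
    (P : probability T R) (b : T -> bool) (x y : R) : measurable_fun setT b ->
  fine 'E_P[fun w => if b w then x else y] =
  x * fine (P [set w | b w]) + y * fine (P [set w | ~~ b w]).
Proof.
move=> mb.
have m1 := measurable_setb mb; have m2 := measurable_setb (measurable_neg mb).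
have ii (S : set T) r : measurable S -> P.-integrable setT (EFin \o (fun w => r * \1_S w)).
  by move=> mS; rewrite (_ : _ \o _ = (fun w => r%:E * (\1_S w)%:E)%E)//;
    apply: integrableZl => //; exact: integrable_indic.
have Ei (S : set T) r : measurable S ->
    fine 'E_P[fun w => r * \1_S w] = r * fine (P S).
  move=> mS; rewrite expectationE; under eq_integral do rewrite EFinM.
  rewrite integralZl//; last exact: integrable_indic.
  by rewrite integral_indic// setIT fineM// fin_num_measure.
rewrite -!Ei// -fine_expectationD//; [|exact: ii|exact: ii].
congr (fine 'E_P[_]); apply/funext => w; rewrite !indicE.
have [bw|bw] := boolP (b w).
  by rewrite mem_set// memNset ?mulr1 ?mulr0 ?addr0//= bw.
by rewrite memNset ?mem_set//= ?mulr1 ?mulr0 ?add0r//; exact/negP.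
Qed.

(** * The identities between expectations under one hypothesis *)

Section delay_identities.
Context {d : measure_display} {Omega : measurableType d} {R : realType} {K : nat}.
Variables (P : probability Omega R) (X : 'I_K -> nat -> Omega -> R).
Variables (D A B : R) (c : 'I_K -> bool -> R).
Hypothesis iidX : iid_process P X.
Hypothesis D0 : 0 < D.
Hypothesis EX0 : forall k, ('E_P[X k 0] != 0)%E.
Hypothesis iX : forall k, P.-integrable setT (EFin \o X k 0).

Local Notation L w := (fun k => cum (path_of X k w)).
Local Notation T w := (ftime D A B c (L w)).
Local Notation NT k w := (samp_count D (L w k) (T w)).
Local Notation tau k := (fun w => (samp_time D (L w k) 1)%:R : R).
Local Notation next k := (fun w => (samp_time D (L w k) (NT k w).+1)%:R : R).

Hypothesis exT : {ae P, forall w, exists t, fstop D A B c (L w) t}.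
Hypothesis iT : P.-integrable setT (EFin \o (fun w => (T w)%:R : R)).

Let gX : {ae P, forall w, forall k, good_path D (L w k)}.
Proof. by apply: ae_good => // k; rewrite -expectationE. Qed.

Let mean_samples_fin k : mean_samples P X D A B c k \is a fin_num.
Proof.
rewrite ge0_fin_numE ?(mean_samples_lty iidX)//.
by apply: le_trans (mean_samples_ge1 P X D A B c k); exact: lee01.
Qed.

Section sensor.
Variable k : 'I_K.
Hypothesis inext : P.-integrable setT (EFin \o next k).
Let itau : P.-integrable setT (EFin \o tau k).
Proof. exact: (integrable_tau iidX gX inext). Qed.

Lemma tau_expectation_gt0 : 0 < fine 'E_P[tau k].
Proof.
apply: (@lt_le_trans _ _ 1) => //; rewrite -lee_fin fineK; last first.
  by rewrite expectationE; exact: integrable_fin_num.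
rewrite expectationE.
have -> : 1%:E = (\int[P]_(w in setT) (1%R : R)%:E)%E.
  by rewrite integral_cst// mul1e; exact: (esym (probability_setT P)).
have mt : measurable_fun setT (EFin \o tau k) := measurable_int _ itau.
apply: ae_ge0_le_integral => //.
apply: filterS gX => w gw _; rewrite lee_fin ler1n.
exact: (@samp_time_ge _ _ _ 1).
Qed.

Lemma next_expectation :
  fine 'E_P[next k] = fine (mean_samples P X D A B c k) * fine 'E_P[tau k].
Proof.
rewrite !expectationE (wald_time iidX D0 gX exT iT inext) fineM//.
exact: integrable_fin_num.
Qed.

Lemma incr_expectation :
  fine 'E_P[fun w => samp_incr D (L w k) 1] = fine 'E_P[tau k] * fine 'E_P[X k 0].
Proof.
rewrite !expectationE (wald_incr iidX gX itau (iX k)) fineM//.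
  exact: (integrable_fin_num measurableT itau).
exact: (integrable_fin_num measurableT (iX k)).
Qed.

End sensor.

Lemma stat_expectation k :
  P.-integrable setT (EFin \o (fun w => c k (samp_bit D (L w k) 1))) ->
  P.-integrable setT (EFin \o (fun w => c k (samp_bit D (L w k) (NT k w).+1))) ->
  fine 'E_P[fun w => \sum_(1 <= n < (NT k w).+1) c k (samp_bit D (L w k) n)] +
  fine 'E_P[fun w => c k (samp_bit D (L w k) (NT k w).+1)] =
  fine (mean_samples P X D A B c k) * fine 'E_P[fun w => c k (samp_bit D (L w k) 1)].
Proof.
move=> ic inx; rewrite -fine_expectationD//; last exact: (integrable_stat iidX iT).
rewrite !expectationE (wald_stat iidX D0 gX exT iT ic) fineM//.
exact: integrable_fin_num.
Qed.

End delay_identities.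

(** * The stopping time with value [+oo] *)

Section extended_stopping_time.
Context {d : measure_display} {Omega : measurableType d} {R : realType} {K : nat}.
Variables (P : probability Omega R) (X : 'I_K -> nat -> Omega -> R).
Variables (D A B : R) (c : 'I_K -> bool -> R).
Hypothesis mX : forall k s, measurable_fun setT (X k s).

Local Notation L w := (fun k => cum (path_of X k w)).
Local Notation T w := (ftime D A B c (L w)).

Definition ftime_ext w : \bar R :=
  if pselect (exists t, fstop D A B c (L w) t) then (T w)%:R%:E else +oo%E.

Let mL k t : measurable_fun setT (fun w => L w k t).
Proof. by apply: measurable_cum => s; exact: mX. Qed.

Let mT : measurable_fun setT (EFin \o (fun w => (T w)%:R : R)).
Proof.
by apply/measurable_EFinP/measurable_natr; apply: measurable_ftime => k s; exact: mL.
Qed.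

Lemma measurable_ftime_ext : measurable_fun setT ftime_ext.
Proof.
have -> : ftime_ext = (fun w => if `[< exists t, fstop D A B c (L w) t >]
    then (EFin \o (fun w => (T w)%:R : R)) w else +oo%E).
  apply/funext => w; rewrite /ftime_ext; case: pselect => h.
    by rewrite ifT//; exact/asboolP.
  by rewrite ifF//; apply/negbTE/asboolPn.
apply: measurable_fun_ifT; [|exact: mT|exact: measurable_cst].
apply: measurable_fun_setb.
rewrite (_ : [set w | _] = \bigcup_t [set w | fstop D A B c (L w) t]).
  by apply: bigcup_measurable => t _; apply: measurable_setb; exact: measurable_fstop.
by apply/seteqP; split => w /=; [move=> /asboolP[t]; exists t|move=> [t _ ht]; apply/asboolP; exists t].
Qed.

Lemma ftime_ext_ge0 w : (0 <= ftime_ext w)%E.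
Proof. by rewrite /ftime_ext; case: pselect => h; rewrite ?lee_fin ?leey. Qed.

Hypothesis fin_ext : (\int[P]_w ftime_ext w < +oo)%E.

Let iext : P.-integrable setT ftime_ext.
Proof.
apply/integrableP; split; first exact: measurable_ftime_ext.
by under eq_integral do rewrite gee0_abs ?ftime_ext_ge0//.
Qed.

(** An integrable variable is finite almost everywhere, so the default 0 of [ftime] is taken on a
    null set only. *)
Lemma ae_stop : {ae P, forall w, exists t, fstop D A B c (L w) t}.
Proof.
apply: filterS (integrable_ae measurableT iext) => w /(_ Logic.I).
by rewrite /ftime_ext; case: pselect.
Qed.

Lemma integrable_ftime : P.-integrable setT (EFin \o (fun w => (T w)%:R : R)).
Proof.
apply: (le_integrable _ mT _ iext) => // w _.
rewrite [leRHS]gee0_abs ?ftime_ext_ge0// gee0_abs ?lee_fin//.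
by rewrite /ftime_ext; case: pselect => h; rewrite ?leey.
Qed.

Lemma integral_ftime_ext : (\int[P]_w ftime_ext w = \int[P]_w ((T w)%:R)%:E)%E.
Proof.
apply: ae_eq_integral => //; first exact: measurable_ftime_ext.
by apply: filterS ae_stop => w ex _; rewrite /ftime_ext; case: pselect.
Qed.

End extended_stopping_time.

Lemma ln_div_opp (R : realType) (p q : R) : 0 <= p -> 0 <= q -> (p = 0 <-> q = 0) ->
  ln (p / q) = - ln (q / p).
Proof.
move=> p0 q0 pq; have [pe|pn] := eqVneq p 0.
  by rewrite pe (pq.1 pe) mul0r ln0// oppr0.
have qn : q != 0 by apply: contra pn => /eqP /pq ->.
by rewrite -lnV ?invf_div// posrE divr_gt0// lt_neqAle eq_sym ?pn ?qn.
Qed.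

(** The formula holds sensor by sensor before division: the relation between [Et] and [El] reduces
    [h k] to [s * Eh k / Et k], and then [M k] cancels from [ET * h k = s * Est k + s * Ehn k - EY k
    * h k]. The sign [s] distinguishes the hypotheses. *)
Lemma delay_algebra (R : realFieldType) K (s ET EhL : R)
    (M Et Eh El EN Ehn Est EY : 'I_K -> R) :
  let h k := s * Eh k / (s * (Et k * El k)) * (s * El k) in
  s != 0 -> (forall k, 0 < Et k) -> (forall k, El k != 0) ->
  (forall k, EN k = M k * Et k) -> (forall k, EN k = ET + EY k) ->
  (forall k, Est k + Ehn k = M k * Eh k) -> EhL = \sum_(k < K) Est k ->
  \sum_(k < K) h k != 0 ->
  ET = (s * EhL + \sum_(k < K) (s * Ehn k - EY k * h k)) / \sum_(k < K) h k.
Proof.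
move=> h s0 Et0 El0 e1 e2 e3 -> h0; apply/(canRL (mulfK h0)).
rewrite !mulr_sumr -big_split/=; apply: eq_bigr => k _.
have hE : h k = s * Eh k / Et k.
  by rewrite /h; field; rewrite s0 El0 lt0r_neq0.
have -> : Est k = M k * Eh k - Ehn k by rewrite -e3 addrK.
have -> : ET = M k * Et k - EY k by rewrite -e1 e2 addrK.
by rewrite hE; field; rewrite lt0r_neq0.
Qed.

(** * Nonnegativity of the information carried by a bit *)

Section bit_information.
Context {d dY : measure_display} {Omega : measurableType d} {Y : measurableType dY}
  {R : realType} {K : nat}.
Variables (P : bool -> probability Omega R) (y : 'I_K -> nat -> Omega -> Y)
  (mu : 'I_K -> {measure set Y -> \bar R}) (f : bool -> 'I_K -> Y -> R) (D : R).
Hypothesis D0 : 0 < D.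
Hypothesis hy_meas : forall k s, measurable_fun setT (y k s).
Hypothesis hf_meas : forall i k, measurable_fun setT (f i k).
Hypothesis hf_ge0 : forall i k x, 0 <= f i k x.
Hypothesis hy_dens : forall i k s (S : set Y), measurable S ->
  P i (y k s @^-1` S) = (\int[mu k]_(x in S) (f i k x)%:E)%E.
Hypothesis hy_indep : forall i,
  mutually_independent (P i) (fun ks : 'I_K * nat => y ks.1 ks.2).
Hypothesis hE_ne0 : forall i k, ('E_(P i)[llr y f k 0] != 0)%E.
Variable k : 'I_K.

Let iid i : iid_process (P i) (llr y f).
Proof. exact: (iid_llr hy_meas hf_meas hf_ge0 hy_dens hy_indep). Qed.

Let mX s : measurable_fun setT (llr y f k s).
Proof. by case: (iid true). Qed.

Lemma measurable_bk n : measurable_fun setT (bk y f D k n).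
Proof.
apply: (@measurable_samp_bit _ _ _ D (fun w => cumLLR y f k w)) => t.
exact: (@measurable_cum _ _ _ (fun w s => llr y f k s w)).
Qed.

Let mb : measurable [set w | bk y f D k 1 w].
Proof. exact: measurable_setb (measurable_bk 1). Qed.
Let mnb : measurable [set w | ~~ bk y f D k 1 w].
Proof. exact: measurable_setb (measurable_neg (measurable_bk 1)). Qed.

Let eq0P (Q : probability Omega R) (S : set Omega) : measurable S ->
  fine (Q S) = 0 <-> Q S = 0%E.
Proof.
by move=> mS; split => [h|->//]; rewrite -[LHS]fineK ?h ?fin_num_measure.
Qed.

(** If the bit is never positive under [P i], neither is a single log-likelihood ratio; this passes
    to [P j] because 0 is not a positive value, and then back to the bit. *)
Let bit_null i j : P i [set w | bk y f D k 1 w] = 0%E ->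
  P j [set w | bk y f D k 1 w] = 0%E.
Proof.
move=> p0; apply: (bit_pos0 D (iid j)).
have V0 (Q : probability Omega R) : Q [set w | 0 < llr y f k 0 w] = Q (llr y f k 0 @^-1` `]0, +oo[).
  by congr (Q _); apply/seteqP; split => w /=; rewrite in_itv/= andbT.
rewrite V0; apply: (llr_null hf_meas hf_ge0 hy_dens (i := i)) => //.
  by rewrite /= in_itv/= ltxx.
rewrite -V0; apply/eqP; rewrite eq_le measure_ge0 andbT leNgt; apply/negP => pos.
by have := bit_pos (iid i) D0 pos; rewrite [X in (_ < X)%E]p0 ltxx.
Qed.

Let bit_conull i j : P i [set w | ~~ bk y f D k 1 w] = 0%E ->
  P j [set w | ~~ bk y f D k 1 w] = 0%E.
Proof.
move=> p0; apply: (bit_neg0 (iid j) D0).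
  have EXj k' : (\int[P j]_w (llr y f k' 0 w)%:E != 0)%E by rewrite -expectationE.
  by apply: filterS (ae_good (iid j) D0 EXj) => w; exact.
have V0 (Q : probability Omega R) : Q [set w | llr y f k 0 w < 0] = Q (llr y f k 0 @^-1` `]-oo, 0[).
  by congr (Q _); apply/seteqP; split => w /=; rewrite in_itv/=.
rewrite V0; apply: (llr_null hf_meas hf_ge0 hy_dens (i := i)) => //.
  by rewrite /= in_itv/= ltxx.
rewrite -V0; apply/eqP; rewrite eq_le measure_ge0 andbT leNgt; apply/negP => neg.
by have := bit_neg (iid i) D0 neg; rewrite [X in (_ < X)%E]p0 ltxx.
Qed.

Let p i := fine (P i [set w | bk y f D k 1 w]).

Let pC i : fine (P i [set w | ~~ bk y f D k 1 w]) = 1 - p i.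
Proof.
rewrite (_ : [set w | ~~ bk y f D k 1 w] = ~` [set w | bk y f D k 1 w]).
  by rewrite probability_setC// fineB// fin_num_measure.
by apply/seteqP; split => w /= /negP.
Qed.

Let p01 i : 0 <= p i <= 1.
Proof.
rewrite fine_ge0//= -lee_fin fineK ?fin_num_measure//.
exact: probability_le1.
Qed.

Let p_eq0 i j : p i = 0 <-> p j = 0.
Proof. by rewrite /p !eq0P//; split; exact: bit_null. Qed.

Let p_eq1 i j : p i = 1 <-> p j = 1.
Proof.
suff h i' j' : p i' = 1 -> p j' = 1 by split; exact: h.
move=> pi1; apply/esym/eqP; rewrite -subr_eq0 -pC; apply/eqP/eq0P => //.
by apply: (bit_conull (i := i')); apply/eq0P => //; rewrite pC pi1 subrr.
Qed.

(** The true law of the bit comes first in the relative entropy, so the two laws exchange roles with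
    [i]. The values depend on the bit alone, so when both vanish they vanish for every [n]. *)
Lemma hI_t1_ge0 i : 0 <= hI_t1 P y f D i k /\
  (hI_t1 P y f D i k = 0 -> forall n w, hlambdak P y f D k n w = 0).
Proof.
have e1 : 1 - betak P y f D k = p true by rewrite /betak pC subKr.
have e0 : betak P y f D k = 1 - p true by rewrite /betak pC.
rewrite /hI_t1 /Info /hlambdak e1 e0 -/(p false).
rewrite fine_expectation_if; last exact: measurable_bk.
rewrite -/(p i) pC.
case: i => /=; rewrite ?mul1r ?mulN1r.
  have [h1 h2] := relative_entropy_ge0 (p01 true) (p01 false) (p_eq0 _ _) (p_eq1 _ _).
  rewrite mulrC [X in _ + X]mulrC; split => // /h2[-> ->] n w.
  by case: ifP.
have [h1 h2] := relative_entropy_ge0 (p01 false) (p01 true) (p_eq0 _ _) (p_eq1 _ _).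
have /andP[t0 t1] := p01 true; have /andP[f0 f1] := p01 false.
(* Under the null hypothesis the ratios have to be inverted; this survives [x / 0 = 0] because the
   two probabilities vanish together. *)
have c1 : ln (p true / p false) = - ln (p false / p true) by apply: ln_div_opp.
have c0 : ln ((1 - p true) / (1 - p false)) = - ln ((1 - p false) / (1 - p true)).
  apply: ln_div_opp; rewrite ?subr_ge0//; have := p_eq1 true false.
  by move=> [a b]; split=> /subr0_eq/esym h; apply/eqP; rewrite subr_eq0 eq_sym; apply/eqP; [exact: a|exact: b].
rewrite c1 c0 mulNr [X in - (_ + X)]mulNr -opprD opprK mulrC [X in _ + X]mulrC.
split => // /h2[-> ->] n w; rewrite oppr0.
by case: ifP.
Qed.

End bit_information.

Theorem theorem1
  (d dY : measure_display) (Omega : measurableType d) (Y : measurableType dY)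
  (R : realType) (K : nat)
  (P : bool -> probability Omega R)
  (y : 'I_K -> nat -> Omega -> Y)
  (mu : 'I_K -> {measure set Y -> \bar R})
  (f : bool -> 'I_K -> Y -> R)
  (D A B : R)
  (* thresholds *)
  (hD : 0 < D) (hA : 0 < A) (hB : 0 < B)
  (* observations are random variables *)
  (hy_meas : forall k s, measurable_fun setT (y k s))
  (* f i k is a density (w.r.t. mu k) of every y^k_t under H_i *)
  (hf_meas : forall i k, measurable_fun setT (f i k))
  (hf_ge0 : forall i k x, 0 <= f i k x)
  (hy_dens : forall i k s (S : set Y), measurable S ->
     P i (y k s @^-1` S) = (\int[mu k]_(x in S) (f i k x)%:E)%E)
  (* under H_i all observations (all sensors, all times) are independent *)
  (hy_indep : forall i,
     mutually_independent (P i) (fun ks : 'I_K * nat => y ks.1 ks.2))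
  (* E_i[l^k_1] <> 0 *)
  (hE_ne0 : forall i k, ('E_(P i)[llr y f k 0] != 0)%E)
  (* all expectations involved are finite *)
  (hint_l : forall i k, (P i).-integrable setT (EFin \o llr y f k 0))
  (hint_lam : forall i k,
     (P i).-integrable setT (EFin \o lambdak y f D k 1))
  (hint_hlam : forall i k,
     (P i).-integrable setT (EFin \o hlambdak P y f D k 1))
  (hint_hLT : forall i,
     (P i).-integrable setT
       (EFin \o (fun w => hL P y f D (Tstop P y f D A B w) w)))
  (hint_next : forall i k,
     (P i).-integrable setT
       (EFin \o (fun w => hlambdak P y f D k (NkT P y f D A B k w).+1 w)))
  (hint_Y : forall i k, (P i).-integrable setT (EFin \o Yk P y f D A B k))
  (hint_T : forall i, (\int[P i]_w Tstop_ext P y f D A B w < +oo)%E) :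
  forall i : bool,
    (\int[P i]_w Tstop_ext P y f D A B w)%E =
    ((hI_T P y f D A B i
      + \sum_(k < K) (hI_next P y f D A B i k
                      - fine ('E_(P i)[Yk P y f D A B k])%E * hI_1k P y f D i k))
     / hI_1 P y f D i)%:E.
Proof.
move=> i.
have iid : iid_process (P i) (llr y f).
  exact: (iid_llr hy_meas hf_meas hf_ge0 hy_dens hy_indep).
have mX k s : measurable_fun setT (llr y f k s) by case: iid.
pose c k (b : bool) := if b then ln ((1 - betak P y f D k) / alphak P y f D k)
  else ln (betak P y f D k / (1 - alphak P y f D k)).
have fin_ext : (\int[P i]_w ftime_ext (llr y f) D A B c w < +oo)%E by exact: hint_T.
have exT := ae_stop mX fin_ext; have iT := integrable_ftime mX fin_ext.
have TE : (\int[P i]_w Tstop_ext P y f D A B w)%E =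
    (fine 'E_(P i)[fun w => (Tstop P y f D A B w)%:R])%:E.
  rewrite expectationE fineK; last exact: (integrable_fin_num measurableT iT).
  exact: (integral_ftime_ext mX fin_ext).
pose nxt k w : R := (tk y f D k (NkT P y f D A B k w).+1 w)%:R.
(* Integrability of the next sampling time is read off from those of [T] and [Y_k]. *)
have nxtE k : nxt k = (fun w => (Tstop P y f D A B w)%:R + Yk P y f D A B k w).
  by apply/funext => w; rewrite /Yk addrC subrK.
have inxt k : (P i).-integrable setT (EFin \o nxt k).
  by rewrite nxtE; exact: (integrableD measurableT iT (hint_Y i k)).
have El0 k : fine 'E_(P i)[llr y f k 0] != 0.
  apply/eqP => h; have /eqP[] := hE_ne0 i k; rewrite -[LHS]fineK ?h//.
  by rewrite expectationE; exact: (integrable_fin_num measurableT (hint_l i k)).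
pose Et k := fine 'E_(P i)[fun w => (tk y f D k 1 w)%:R : R].
have Et0 k : 0 < Et k by exact: (tau_expectation_gt0 iid hD (hE_ne0 i) (inxt k)).
have lamE k : fine 'E_(P i)[lambdak y f D k 1] = Et k * fine 'E_(P i)[llr y f k 0].
  exact: (incr_expectation iid hD (hE_ne0 i) (hint_l i) (inxt k)).
pose s : R := if i then 1 else -1.
have s0 : s != 0 by rewrite /s; case: (i); rewrite ?oppr_eq0 oner_eq0.
have hI_1kE k : hI_1k P y f D i k = s * fine 'E_(P i)[hlambdak P y f D k 1] /
    (s * (Et k * fine 'E_(P i)[llr y f k 0])) * (s * fine 'E_(P i)[llr y f k 0]).
  by rewrite /hI_1k /hI_t1 /I_t1 /I_1 /Info lamE.
(* The mean of the log-likelihood ratio cancels, whatever its sign, so that [hI_1k] inherits the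
   sign of the relative entropy. *)
have hI_1k_div k : hI_1k P y f D i k = hI_t1 P y f D i k / Et k.
  rewrite hI_1kE /hI_t1 /Info -/s; field.
  by rewrite s0 El0 lt0r_neq0.
have hinfo k := hI_t1_ge0 hD hy_meas hf_meas hf_ge0 hy_dens hy_indep hE_ne0 k i.
have hI_1_neq0 : hI_1 P y f D i != 0.
  have hge k : 0 <= hI_1k P y f D i k.
    by rewrite hI_1k_div divr_ge0 ?(ltW (Et0 k))//; case: (hinfo k).
  apply/eqP => /(psumr_eq0P (fun k _ => hge k)) h0.
  have hl0 k : forall n w, hlambdak P y f D k n w = 0.
    case: (hinfo k) => _; apply; move/eqP: (h0 k isT).
    by rewrite hI_1k_div mulf_eq0 invr_eq0 (gt_eqF (Et0 k)) orbF => /eqP.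
  (* A property that holds almost surely holds somewhere, so one path that stops can be picked. Its
     statistic is an empty or zero sum, which lies in [(- B, A)]; the case [K = 0] is included. *)
  have PF : ProperFilter (almost_everywhere (P i)).
    apply: ae_properfilter_algebraOfSetsType.
    by rewrite [X in (_ < X)%E]probability_setT lte01.
  have [w [t st]] := @filter_ex _ _ PF _ exT.
  have : stop_pred P y f D A B w t := st.
  rewrite /stop_pred /hL big1 => [|k _]; last by rewrite big1.
  by rewrite in_itv/= oppr_lt0 hB hA andbF.
rewrite TE; congr EFin.
rewrite /hI_T /hI_next /Info -/s; under eq_bigr do rewrite hI_1kE.
have hsE : hI_1 P y f D i = \sum_(k < K) (s * fine 'E_(P i)[hlambdak P y f D k 1] /
    (s * (Et k * fine 'E_(P i)[llr y f k 0])) * (s * fine 'E_(P i)[llr y f k 0])).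
  by apply: eq_bigr => k _; exact: hI_1kE.
rewrite hsE in hI_1_neq0 *.
pose stat k w : R := \sum_(1 <= n < (NkT P y f D A B k w).+1) hlambdak P y f D k n w.
have istat k : (P i).-integrable setT (EFin \o stat k).
  exact: (integrable_stat (c := c) iid iT k).
apply: (@delay_algebra _ _ _ _ _ (fun k => fine (mean_samples (P i) (llr y f) D A B c k)) Et _ _
  (fun k => fine 'E_(P i)[nxt k]) _ (fun k => fine 'E_(P i)[stat k])) => //.
- by move=> k; exact: (next_expectation iid hD (hE_ne0 i) exT iT (inxt k)).
- by move=> k; rewrite nxtE fine_expectationD.
- move=> k; exact: (stat_expectation iid hD (hE_ne0 i) exT iT (hint_hlam i k) (hint_next i k)).
- by rewrite -fine_expectation_sum.
Qed.
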